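(* Let $K$ be a field, $1\le r<n$, $S'=K[x_1,\ldots,x_r]$, $S''=K[x_{r+1},\ldots,x_n]$ and $S=K[x_1,\ldots,x_n]$. Let $I\subset S'$ and $J\subset S''$ be monomial ideals, and let $IS$, $JS$ denote the ideals they generate in $S$. Then: (1) $\operatorname{sdepth}_S(IS)\ \ge\ \operatorname{sdepth}_S(IS+JS)\ \ge\ \min\{\operatorname{sdepth}_S(IS),\ \operatorname{sdepth}_{S''}(J)+\operatorname{sdepth}_{S'}(S'/I)\}$. (2) $\operatorname{sdepth}_S(IS\cap JS)\ \ge\ \operatorname{sdepth}_{S'}(I)+\operatorname{sdepth}_{S''}(J)$. (3) $\operatorname{sdepth}_S(S/IS)\ \ge\ \operatorname{sdepth}_S(S/(IS\cap JS))\ \ge\ \min\{\operatorname{sdepth}_S(S/IS),\ \operatorname{sdepth}_{S''}(S''/J)+\operatorname{sdepth}_{S'}(I)\}$. (4) $\operatorname{sdepth}_S(S/(IS+JS))\ \ge\ \operatorname{sdepth}_{S'}(S'/I)+\operatorname{sdepth}_{S''}(S''/J)$. (5) $\operatorname{depth}_S(S/(IS\cap JS))-1=\operatorname{depth}_S(S/(IS+JS))=\operatorname{depth}_{S'}(S'/I)+\operatorname{depth}_{S''}(S''/J)$. (6) $\operatorname{depth}_S(IS\cap JS)=\operatorname{depth}_S(IS+JS)+1=\operatorname{depth}_{S'}(I)+\operatorname{depth}_{S''}(J)$, and $\operatorname{depth}_S((IS+JS)/IS)=\operatorname{depth}_S(IS+JS)$.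
   Context: Let $R$ be a polynomial ring over a field $K$ in a finite set of variables $X$, with its multigrading by exponent vectors, and let $M$ be a multigraded $R$-module. A Stanley decomposition of $M$ is a direct sum decomposition of $K$-vector spaces $\mathcal D: M=\bigoplus_{i=1}^t m_iK[Z_i]$, where $m_i\in M$ and $Z_i\subset X$ are such that $m_iK[Z_i]$ is a free $K[Z_i]$-module. Put $\operatorname{sdepth}(\mathcal D)=\min_{i=1}^t|Z_i|$. The Stanley depth $\operatorname{sdepth}_R(M)$ is the maximum of $\operatorname{sdepth}(\mathcal D)$ over all Stanley decompositions $\mathcal D$ of $M$. As usual, $\operatorname{depth}_R(M)$ denotes the depth of $M$ with respect to the ideal generated by all variables of $R$.
   Formalization: Part (1) is stated for J ≠ S'', part (3) for J ≠ 0, and parts (5) and (6) for I and J both nonzero and proper, since the claims fail for these degenerate ideals (e.g. J = S'' in (1) would give sdepth(IS) ≥ n). *)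

(* Defs.v *)
From mathcomp Require Export all_boot all_order all_algebra.
From mathcomp Require Export boolp classical_sets.
From mathcomp Require Export mpoly.

Set Implicit Arguments.
Unset Strict Implicit.
Unset Printing Implicit Defensive.

Import GRing.Theory.

Local Open Scope classical_set_scope.
Local Open Scope ring_scope.

Section Ideals.
Context {R : comNzRingType}.
Implicit Types A B X : set R.

Definition ideal_span X : set R :=
  [set f | exists t (a b : 'I_t -> R),
     (forall i, X (b i)) /\ f = \sum_(i < t) a i * b i].

Definition zero_ideal : set R := [set 0].

Definition idealD A B : set R := [set f + g | f in A & g in B].

Definition idealM A B : set R := ideal_span [set f * g | f in A & g in B].

End Ideals.

(* Modules over the polynomial ring {mpoly K[n]} are given as quotients A / B
   of ideals with B contained in A: an ideal I is I / zero_ideal and a cyclic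
   module is setT / I.  Elements of A / B are represented by elements of A. *)
Section StanleyDepth.
Context {K : fieldType} {n : nat}.
Local Notation S := {mpoly K[n]}.
Implicit Types (A B I : set S) (Z : {set 'I_n}).

Definition monomial_ideal I : Prop :=
  exists U : set 'X_{1..n}, I = ideal_span [set 'X_[K, u] | u in U].

Definition subpolyring Z : set S :=
  [set f | forall u : 'X_{1..n}, u \in msupp f ->
             forall i, i \notin Z -> u i = 0%N].

(* The nonzero multigraded components of S are the lines spanned by monomials. *)
Definition mhomogeneous (f : S) : Prop :=
  exists (c : K) (u : 'X_{1..n}), f = c *: 'X_[u].

(* The decomposition is one of multigraded vector spaces, so the generators are
   homogeneous.  The last three clauses say that, modulo B, each m_i K[Z_i] is
   free on m_i, the m_i K[Z_i] span A, and their sum is direct. *)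
Definition Stanley_decomposition A B (t : nat)
    (m : 'I_t -> S) (Z : 'I_t -> {set 'I_n}) : Prop :=
  [/\ forall i, mhomogeneous (m i),
      forall i, A (m i),
      forall i f, subpolyring (Z i) f -> B (m i * f) -> f = 0,
      forall f, A f -> exists g : 'I_t -> S,
        (forall i, subpolyring (Z i) (g i)) /\ B (f - \sum_(i < t) m i * g i)
    & forall g : 'I_t -> S, (forall i, subpolyring (Z i) (g i)) ->
        B (\sum_(i < t) m i * g i) -> forall i, B (m i * g i)].

(* Since #|Z i| <= n, starting the minimum at n is harmless; it only fixes the
   value n for the empty decomposition of the zero module. *)
Definition sdepth_dec (t : nat) (Z : 'I_t -> {set 'I_n}) : nat :=
  \big[minn/n]_(i < t) #|Z i|.

(* The set below is nonempty for monomial ideals and bounded by n, so the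
   supremum is a maximum. *)
Definition sdepth A B : nat :=
  supremum 0%N [set d | exists t (m : 'I_t -> S) (Z : 'I_t -> {set 'I_n}),
    Stanley_decomposition A B m Z /\ d = sdepth_dec Z].

End StanleyDepth.

Section Depth.
Context {K : fieldType} {n : nat}.
Local Notation S := {mpoly K[n]}.
Implicit Types (A B : set S) (fs : seq S).

Definition max_ideal : set S := ideal_span [set 'X_i | i in [set: 'I_n]].

(* The submodule B + (fs)A of A, so that A / kill A B fs is M / (fs)M for
   M = A / B. *)
Definition kill A B fs : set S :=
  idealD B (idealM (ideal_span [set f | f \in fs]) A).

Definition regular_sequence A B fs : Prop :=
  (forall i, (i < size fs)%N -> forall g, A g ->
     kill A B (take i fs) (fs`_i * g) -> kill A B (take i fs) g) /\
  ~ (A `<=` kill A B fs).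

(* For A / B nonzero the lengths of regular sequences are bounded by n, so the
   supremum is a maximum. *)
Definition depth A B : nat :=
  supremum 0%N [set d | exists fs, [/\ size fs = d,
    forall f, f \in fs -> max_ideal f & regular_sequence A B fs]].

End Depth.

Section Extension.
Context {K : fieldType}.

Definition rename_vars (k n : nat) (h : 'I_k -> 'I_n) (p : {mpoly K[k]}) :
    {mpoly K[n]} := p \mPo [tuple 'X_(h i) | i < k].

(* The ideal generated in K[x_1, ..., x_(r+s)] by an ideal of the polynomial
   ring in the first r, resp. the last s, variables. *)
Definition extl (r s : nat) (I : set {mpoly K[r]}) : set {mpoly K[r + s]} :=
  ideal_span (rename_vars (@lshift r s) @` I).

Definition extr (r s : nat) (J : set {mpoly K[s]}) : set {mpoly K[r + s]} :=
  ideal_span (rename_vars (@rshift r s) @` J).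

End Extension.

(* Main.v *)
Require Import Defs.
From mathcomp Require Import all_boot all_order all_algebra.
From mathcomp Require Import boolp classical_sets.
From mathcomp Require Import mpoly.
From mathcomp Require Import ring zify.

Set Implicit Arguments.
Unset Strict Implicit.
Unset Printing Implicit Defensive.

Import Order.TTheory GRing.Theory.

Local Open Scope classical_set_scope.
Local Open Scope ring_scope.

(** A monomial ideal is the span of the monomials whose exponents lie in an upset
    of exponent vectors, so every ideal of the theorem becomes a set of exponents,
    written [mset P] below.

    Stanley depth.  A Stanley decomposition of [mset P / mset Q] is the same as a
    partition of [P `\` Q] into finitely many cones, a cone consisting of the
    vectors obtained from [u] by raising the coordinates in [Z]
    ([Stanley_decomposition_cones], [cones_Stanley_decomposition]).  Dickson's
    lemma provides such partitions, hence maxima.  The lower bounds follow by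
    taking products of cones in the two groups of variables and disjoint unions:
    the exponents of [IS + JS] are those of [IS] together with the pairs of an
    exponent outside [I] and one of [J], and dually for the complement of the
    intersection.  The upper bounds follow by slicing a partition at one fixed
    exponent of the second group.

    Depth.  The module [A / B] is studied through [depth_ge d A B], the existence
    of a regular sequence of length [d].  Three general facts carry the proof.
    - Rees' theorem ([depth_ge_quotient]): if there is a regular sequence of length
      [d + 1] in an ideal then there is one starting with any given regular element
      of that ideal.  It rests on prime avoidance, applied to the finitely many maximal annihilators, and on
      the exchange of socle elements ([socle_free_exchange]).  Two depth
      inequalities for short exact sequences follow by induction
      ([depth_ge_sub], [depth_ge_quo]).
    - Additivity on tensor products over the field ([depth_tens_mset]).  Regular
      sequences of the factors stay regular by flatness ([tens_regular]), and if the
      quotients by them both have a socle then so does the tensor product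
      ([socle_tens]); by Rees' theorem no longer sequence exists.
    - A nonzero proper ideal [I] has [depth I = depth (S / I) + 1]
      ([depth_ideal]).  This needs [depth (S / I) < n]: a nonzero element of [I]
      followed by a regular sequence of length [n] on [S / I] would consist of
      [n + 1] algebraically independent polynomials in [n] variables, which a count
      of monomials excludes ([no_long_regular_chain]).

    Now [S / (IS + JS)] is the tensor product of [S' / I] and [S'' / J], the ideal
    [IS `&` JS] that of [I] and [J], and [(IS + JS) / IS], which is isomorphic to
    [JS / (IS `&` JS)], that of [S' / I] and [J].  All the depths follow. *)

(** * Monotone subsequences of exponent vectors and the ascending chain condition *)

Lemma nondecreasing_subsequence (f : nat -> nat) :
  exists phi : nat -> nat,
    {homo phi : i j / (i < j)%N} /\ {homo f \o phi : i j / (i <= j)%N}.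
Proof.
have minf N : exists m, (N <= m)%N /\ forall j, (N <= j)%N -> (f m <= f j)%N.
  have ex : exists v, `[< exists2 m, (N <= m)%N & f m = v >].
    by exists (f N); apply/asboolP; exists N.
  case: (ex_minnP ex) => v /asboolP[m Nm <-] vmin.
  by exists m; split=> // j Nj; apply: vmin; apply/asboolP; exists j.
have [g gP] := choice minf.
pose phi := fix phi k := if k is k'.+1 then g (phi k').+1 else g 0%N.
exists phi; split; first by apply: homo_ltn => [|k]; [exact: ltn_trans|exact: (gP (phi k).+1).1].
apply: homo_leq => [//||k]; first exact: leq_trans.
have lt_phi : (phi k < phi k.+1)%N by exact: (gP (phi k).+1).1.
case: k lt_phi => [|k] lt_phi; first exact: (gP 0%N).2.
apply: (gP (phi k).+1).2; exact: leq_trans (gP (phi k).+1).1 (ltnW lt_phi).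
Qed.

(** Dickson's lemma in its sequential form: extract a subsequence for one
    coordinate after the other. *)
Lemma dickson n (f : nat -> 'X_{1..n}) :
  exists phi : nat -> nat, {homo phi : i j / (i < j)%N} /\
    forall i j, (i <= j)%N -> (f (phi i) <= f (phi j))%MM.
Proof.
suff [phi [phi_inc phiP]] : exists phi : nat -> nat,
    {homo phi : i j / (i < j)%N} /\ forall c, c \in enum 'I_n ->
      {homo (fun k => f (phi k) c) : i j / (i <= j)%N}.
  exists phi; split=> // i j ij; apply/mnm_lepP => c.
  by apply: (phiP c) => //; rewrite mem_enum.
elim: (enum 'I_n) => [|c l [phi [phi_inc phiP]]]; first by exists id; split.
have [psi [psi_inc psiP]] := nondecreasing_subsequence (fun k => f (phi k) c).
exists (phi \o psi); split=> [i j ij|d]; first exact/phi_inc/psi_inc.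
rewrite inE => /orP[/eqP->|dl] i j ij; first exact: (psiP i j ij).
apply: (phiP d dl); move: ij; rewrite leq_eqVlt => /orP[/eqP->//|ij].
exact/ltnW/psi_inc.
Qed.

Definition upset n (P : set 'X_{1..n}) : Prop :=
  forall u w, (u <= w)%MM -> P u -> P w.

Definition mnm_trunc n N (u : 'X_{1..n}) : 'X_{1..n} :=
  [multinom minn (u i) N | i < n].

Lemma mnm_trunc_le n N (u : 'X_{1..n}) : (mnm_trunc N u <= u)%MM.
Proof. by apply/mnm_lepP => i; rewrite mnmE geq_minl. Qed.

(** Any [N0] that bounds the exponents of the finitely many minimal elements of [P]
    will do; the proof finds it without naming these elements. *)
Lemma upset_trunc n (P : set 'X_{1..n}) : upset P ->
  exists N0, forall N, (N0 <= N)%N -> forall u, P u -> P (mnm_trunc N u).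
Proof.
move=> upP; apply: contrapT => nN.
have bad N : exists u, exists2 M, (N <= M)%N & P u /\ ~ P (mnm_trunc M u).
  apply: contrapT => h; apply: nN; exists N => M NM u Pu.
  by apply: contrapT => ?; apply: h; exists u, M.
have [f fP] := choice bad.
have [phi [phi_inc phi_le]] := dickson f.
(* Truncating at or above [K] keeps a vector above the first one of the
   subsequence. *)
pose K := (\max_i f (phi 0%N) i)%N.
have phi_ge k : (k <= phi k)%N.
  by elim: k => // k ih; apply: leq_ltn_trans ih _; exact: phi_inc.
have [M KM [_ nP]] := fP (phi K); apply: nP.
have [_ _ [P0 _]] := fP (phi 0%N).
apply: upP P0; apply/mnm_lepP => i; rewrite mnmE leq_min; apply/andP; split.
  exact: (mnm_lepP (phi_le 0%N K _)).
apply: leq_trans (leq_trans (phi_ge K) KM).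
exact: (leq_bigmax (F := fun i => f (phi 0%N) i)).
Qed.

Section Ideals.
Context {R : comNzRingType}.
Implicit Types A B C I : set R.

Record is_ideal A : Prop := IsIdeal {
  ideal_0 : A 0;
  ideal_D : forall a b, A a -> A b -> A (a + b);
  ideal_M : forall r a, A a -> A (r * a) }.

Lemma ideal_N A a : is_ideal A -> A a -> A (- a).
Proof. by move=> iA Aa; rewrite -mulN1r; exact: ideal_M. Qed.

Lemma ideal_B A a b : is_ideal A -> A a -> A b -> A (a - b).
Proof. by move=> iA Aa Ab; apply: ideal_D => //; exact: ideal_N. Qed.

Lemma ideal_Mr A r a : is_ideal A -> A a -> A (a * r).
Proof. by move=> iA Aa; rewrite mulrC; exact: ideal_M. Qed.

Lemma ideal_sum A (J : Type) (s : seq J) (p : pred J) (F : J -> R) :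
  is_ideal A -> (forall i, p i -> A (F i)) -> A (\sum_(i <- s | p i) F i).
Proof.
move=> iA AF; apply: (big_ind A) => //; [exact: ideal_0|exact: ideal_D].
Qed.

Lemma ideal_setT : is_ideal (setT : set R). Proof. by []. Qed.

Lemma ideal_zero : is_ideal (zero_ideal : set R).
Proof.
by split=> [//|a b /= -> ->|r a /= ->]; rewrite ?addr0 ?mulr0.
Qed.

Lemma ideal_idealD A B : is_ideal A -> is_ideal B -> is_ideal (idealD A B).
Proof.
move=> iA iB; split=> [|_ _ [a Aa [b Bb <-]] [a' Aa' [b' Bb' <-]]|r _ [a Aa [b Bb <-]]].
- by exists 0; [exact: ideal_0|exists 0; [exact: ideal_0|rewrite addr0]].
- exists (a + a'); first exact: ideal_D.
  by exists (b + b'); [exact: ideal_D|rewrite addrACA].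
- exists (r * a); first exact: ideal_M.
  by exists (r * b); [exact: ideal_M|rewrite mulrDr].
Qed.

Lemma ideal_setI A B : is_ideal A -> is_ideal B -> is_ideal (A `&` B).
Proof.
move=> iA iB; split; first by split; exact: ideal_0.
  by move=> a b [? ?] [? ?]; split; exact: ideal_D.
by move=> r a [? ?]; split; exact: ideal_M.
Qed.

Lemma ideal_ideal_span (X : set R) : is_ideal (ideal_span X).
Proof.
split.
- by exists 0%N, (fun=> 0), (fun=> 0); split=> [[]//|]; rewrite big_ord0.
- move=> _ _ [t [a [b [Xb ->]]]] [t' [a' [b' [Xb' ->]]]].
  exists (t + t')%N, (fun i => match split i with inl j => a j | inr j => a' j end),
    (fun i => match split i with inl j => b j | inr j => b' j end).
  split=> [i|]; first by case: split.
  rewrite big_split_ord /=; congr (_ + _); apply: eq_bigr => i _.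
    by rewrite (unsplitK (inl i)).
  by rewrite (unsplitK (inr i)).
- move=> r _ [t [a [b [Xb ->]]]]; exists t, (fun i => r * a i), b; split=> //.
  by rewrite mulr_sumr; apply: eq_bigr => i _; rewrite mulrA.
Qed.

Lemma ideal_span_incl (X : set R) : X `<=` ideal_span X.
Proof.
by move=> x Xx; exists 1%N, (fun=> 1), (fun=> x); rewrite big_ord1 mul1r.
Qed.

Lemma ideal_span_min (X A : set R) : is_ideal A -> X `<=` A -> ideal_span X `<=` A.
Proof.
move=> iA XA _ [t [a [b [Xb ->]]]]; apply: ideal_sum => // i _.
by apply: ideal_M => //; exact/XA.
Qed.

Definition noetherian : Prop :=
  forall F : set (set R), (forall I, F I -> is_ideal I) -> (exists I, F I) ->
    exists I, F I /\ forall J, F J -> I `<=` J -> J `<=` I.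

End Ideals.
Arguments noetherian R : clear implicits.

(** Hilbert's basis theorem, through leading monomials.  In a strictly increasing
    chain of ideals pick elements that are new and have the smallest possible
    leading monomial.  One of these leading monomials divides a later one, and
    cancelling the later one gives an element that is new at the later step and has
    a smaller leading monomial. *)
Lemma mpoly_noetherian (K : fieldType) n : noetherian {mpoly K[n]}.
Proof.
move=> F Fid [I0 FI0]; apply: contrapT => nmax.
have next I : exists J, F I -> [/\ F J, I `<=` J & ~ J `<=` I].
  have [FI|nFI] := pselect (F I); last by exists I.
  apply: contrapT => h; apply: nmax; exists I; split=> // J FJ IJ.
  by apply: contrapT => ?; apply: h; exists J.
have [nx nxP] := choice next.
pose c k := iter k nx I0.
have Fc k : F (c k) by elim: k => //= k /nxP[].
have cD k : c k `<=` c k.+1 by case: (nxP _ (Fc k)).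
have c_le i j : (i <= j)%N -> c i `<=` c j.
  elim: j => [|j ih]; first by rewrite leqn0 => /eqP->.
  by rewrite leq_eqVlt => /orP[/eqP->//|/ih h x /h/cD].
have new k : exists f, [/\ c k.+1 f, ~ c k f &
    forall g, c k.+1 g -> ~ c k g -> (mlead f <= mlead g)%O].
  apply: contrapT => h.
  have : forall m g, mlead g = m -> c k.+1 g -> c k g.
    apply: ltmwf => m ih g lead_g cg; apply: contrapT => ncg; apply: h.
    exists g; split=> // g' cg' ncg'; rewrite leNgt; apply/negP => lt_g'.
    by apply: ncg'; apply: ih cg' => //; rewrite -lead_g.
  by case: (nxP _ (Fc k)) => _ _ ns h'; apply: ns => g; exact: (h' _ g).
have [f fP] := choice new.
have [phi [phi_inc phi_le]] := dickson (fun k => mlead (f k)).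
have lt01 : (phi 0 < phi 1)%N by exact: phi_inc.
have le01 := phi_le 0%N 1%N isT.
move: (phi 0%N) (phi 1%N) lt01 le01 => i j ij lead_ij.
have [ci nci _] := fP i; have [cj ncj minj] := fP j.
have nz k : ~ c k (f k) -> f k != 0.
  by move=> nck; apply/eqP => fk0; apply: nck; rewrite fk0; exact: ideal_0 (Fid _ (Fc k)).
have id_c k := Fid _ (Fc k).
have {}ci : c j (f i) by exact: c_le ci.
pose a := mleadc (f j) / mleadc (f i).
pose v := (mlead (f j) - mlead (f i))%MM.
have vE : (v + mlead (f i))%MM = mlead (f j) by exact: submK.
have lc_i : mleadc (f i) != 0 by rewrite mleadc_eq0 nz.
pose h := a *: (f i * 'X_[v]).
have h_le : (mlead h <= mlead (f j))%O.
  rewrite /h; apply: le_trans (mleadZ_le _ _) _.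
  by apply: le_trans (mleadM_le _ _) _; rewrite mleadXm addmC vE.
have hE : h@_(mlead (f j)) = mleadc (f j).
  by rewrite /h mcoeffZ -{1}vE mcoeffMX /a divfK.
have ch : c j h by rewrite /h scalerAr; exact: ideal_Mr.
have ncg : ~ c j (f j - h).
  by move=> cg; apply: ncj; rewrite -(subrK h (f j)); exact: ideal_D.
have cg : c j.+1 (f j - h) by apply: ideal_B => //; exact: cD.
have lead_g : mlead (f j - h) = mlead (f j).
  apply/eqP; rewrite eq_le minj // andbT.
  by apply: le_trans (mleadB_le _ _) _; rewrite leUx lexx.
have : f j - h != 0.
  by apply/eqP => g0; apply: ncg; rewrite g0; exact: ideal_0.
by rewrite -mleadc_eq0 lead_g mcoeffB hE subrr eqxx.
Qed.
(** * Regular sequences on subquotients of a noetherian ring *)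

Section RegularSequences.
Context {R : comNzRingType}.
Implicit Types (A B C I m p : set R) (f g z : R).

Definition regular f A B : Prop := forall g, A g -> B (f * g) -> B g.

Definition addmul B f A : set R := idealD B [set f * a | a in A].

Lemma addmulP B f A x :
  addmul B f A x <-> exists a, A a /\ B (x - f * a).
Proof.
split=> [[b Bb [_ [a Aa <-] <-]]|[a [Aa Bx]]]; first by exists a; rewrite addrK.
by exists (x - f * a) => //; exists (f * a); [exists a|rewrite subrK].
Qed.

Lemma ideal_image_mul f A : is_ideal A -> is_ideal [set f * a | a in A].
Proof.
move=> iA; split=> [|_ _ [a Aa <-] [b Ab <-]|r _ [a Aa <-]].
- by exists 0; [exact: ideal_0|rewrite mulr0].
- by exists (a + b); [exact: ideal_D|rewrite mulrDr].
- by exists (r * a); [exact: ideal_M|rewrite mulrCA].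
Qed.

Lemma ideal_addmul B f A : is_ideal A -> is_ideal B -> is_ideal (addmul B f A).
Proof. by move=> iA iB; apply: ideal_idealD => //; exact: ideal_image_mul. Qed.

Lemma addmul_incl B f A : is_ideal A -> B `<=` addmul B f A.
Proof.
move=> iA x Bx; apply/addmulP; exists 0; split; first exact: ideal_0.
by rewrite mulr0 subr0.
Qed.

Lemma addmul_mul B f A a : is_ideal B -> A a -> addmul B f A (f * a).
Proof. by move=> iB Aa; apply/addmulP; exists a; rewrite subrr; split=> //; exact: ideal_0. Qed.

Lemma addmul_min B f A C : is_ideal A -> B `<=` C -> A `<=` C -> is_ideal C ->
  addmul B f A `<=` C.
Proof.
move=> iA BC AC iC _ [b /BC Cb [_ [a /AC Ca <-] <-]].
by apply: ideal_D => //; exact: ideal_M.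
Qed.

Lemma addmulS B B' f A A' : B `<=` B' -> A `<=` A' -> addmul B f A `<=` addmul B' f A'.
Proof.
move=> BB AA x /addmulP[a [/AA Aa /BB Bx]]; apply/addmulP; by exists a.
Qed.

Lemma addmulC B f g A : addmul (addmul B f A) g A = addmul (addmul B g A) f A.
Proof.
have sub f' g' : addmul (addmul B f' A) g' A `<=` addmul (addmul B g' A) f' A.
  move=> x /addmulP[a [Aa /addmulP[b [Ab Bx]]]].
  by apply/addmulP; exists b; split=> //; apply/addmulP; exists a; split; rewrite // addrAC.
by rewrite eqEsubset; split; exact: sub.
Qed.

(** Two regular elements may be exchanged as soon as the second one is regular on
    the module itself. *)
Lemma regular_swap f h A B : is_ideal A -> is_ideal B ->
  regular f A B -> regular h A (addmul B f A) -> regular f A (addmul B h A).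
Proof.
move=> iA iB rf rh u Au /addmulP[v [Av Bv]].
have /(rh v Av)/addmulP[a [Aa Ba]] : addmul B f A (h * v).
  apply/addmulP; exists u; split=> //.
  by rewrite -opprB; exact: ideal_N.
apply/addmulP; exists a; split=> //; apply: rf.
  by apply: ideal_B => //; exact: ideal_M.
have -> : f * (u - h * a) = (f * u - h * v) + h * (v - f * a) by ring.
by apply: ideal_D => //; exact: ideal_M.
Qed.

Definition socle_free m A B : Prop :=
  forall z, A z -> (forall f, m f -> B (f * z)) -> B z.

(** Multiplication by [f] and division by [g] carry the socle modulo [g] into the
    socle modulo [f]. *)
Lemma socle_free_exchange m f g A B : is_ideal A -> is_ideal B -> m f ->
  regular f A B -> regular g A B ->
  socle_free m A (addmul B f A) -> socle_free m A (addmul B g A).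
Proof.
move=> iA iB mf rf rg sf u Au mu.
have /addmulP[v [Av Bv]] := mu f mf.
have /(sf v Av)/addmulP[a [Aa Ba]] : forall t, m t -> addmul B f A (t * v).
  move=> t /mu/addmulP[w [Aw Bw]]; apply/addmulP; exists w; split=> //.
  apply: rg; first by apply: ideal_B => //; exact: ideal_M.
  have -> : g * (t * v - f * w) = f * (t * u - g * w) - t * (f * u - g * v) by ring.
  by apply: ideal_B => //; exact: ideal_M.
apply/addmulP; exists a; split=> //; apply: rf.
  by apply: ideal_B => //; exact: ideal_M.
have -> : f * (u - g * a) = (f * u - g * v) + g * (v - f * a) by ring.
by apply: ideal_D => //; exact: ideal_M.
Qed.

(** ** Associated primes and prime avoidance *)

Definition colon B z : set R := [set f | B (f * z)].

Definition prime_ideal p : Prop :=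
  [/\ is_ideal p, ~ p 1 & forall a b, p (a * b) -> p a \/ p b].

Lemma ideal_colon B z : is_ideal B -> is_ideal (colon B z).
Proof.
move=> iB; split=> [|a b Ba Bb|r a Ba]; rewrite /colon /= ?mul0r ?mulrDl -?mulrA.
- exact: ideal_0.
- exact: ideal_D.
- exact: ideal_M.
Qed.

Lemma prime_avoid_mul (T : eqType) (P : T -> set R) (l : seq T) p s :
  prime_ideal p -> ~ p s -> (forall y, y \in l -> is_ideal (P y) /\ ~ P y `<=` p) ->
  exists r, ~ p (r * s) /\ forall y, y \in l -> P y (r * s).
Proof.
move=> [ip _ pM] ps; elim: l => [|x l ih] lP; first by exists 1; rewrite mul1r.
have [|r [pr rP]] := ih; first by move=> y yl; apply: lP; rewrite inE yl orbT.
have [ix /existsNP[t /not_implyP[xt npt]]] := lP x (mem_head _ _).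
exists (t * r); rewrite -mulrA; split; first by move=> /pM[].
move=> y; rewrite inE => /orP[/eqP->|yl]; first by rewrite mulrC; exact: ideal_M.
by apply: ideal_M; [case: (lP y); rewrite ?inE ?yl ?orbT|exact: rP].
Qed.

(** If [f] avoids the earlier primes but lies in the new prime [p], add to it an
    element outside [p] that lies in all earlier primes not contained in [p]. *)
Lemma prime_avoidance m (ps : seq (set R)) : is_ideal m ->
  (forall p, p \in ps -> prime_ideal p /\ ~ m `<=` p) ->
  exists2 f, m f & forall p, p \in ps -> ~ p f.
Proof.
move=> im; elim: ps => [|p ps ih] psP; first by exists 0; [exact: ideal_0|].
have [|f mf fP] := ih; first by move=> q qs; apply: psP; rewrite inE qs orbT.
have [pp /existsNP[s /not_implyP[ms nps]]] := psP p (mem_head _ _).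
have [pf|npf] := pselect (p f); last first.
  by exists f => // q; rewrite inE => /orP[/eqP->|/fP].
have [|r [npr rP]] := @prime_avoid_mul _ id [seq q <- ps | ~~ `[<q `<=` p>]] p s pp nps.
  move=> q; rewrite mem_filter => /andP[/asboolPn nqp qs]; split=> //.
  by case: (psP q); rewrite ?inE ?qs ?orbT // => -[].
have [ip _ _] := pp.
have npfr : ~ p (f + r * s).
  by move=> h; apply: npr; rewrite -(addKr f (r * s)); apply: ideal_D => //; exact: ideal_N.
exists (f + r * s); first by apply: ideal_D => //; exact: ideal_M.
move=> q; rewrite inE => /orP[/eqP->//|qs].
have [qp|nqp] := pselect (q `<=` p); first by move=> /qp.
have [[iq _ _] _] : prime_ideal q /\ ~ m `<=` q by apply: psP; rewrite inE qs orbT.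
move=> h; apply: (fP q qs); rewrite -(addrK (r * s) f); apply: ideal_B => //.
by apply: rP; rewrite mem_filter qs andbT; exact/asboolPn.
Qed.

Hypothesis noethR : noetherian R.

(** The primes are the maximal annihilators of elements of [A / B].  They are
    finitely many: in a maximal submodule generated by elements with maximal
    annihilators lie all such elements, and a prime containing an intersection of
    finitely many ideals contains one of them. *)
Lemma finite_associated_primes A B : is_ideal A -> is_ideal B ->
  exists ps : seq (set R),
    (forall p, p \in ps -> prime_ideal p /\ exists z, [/\ A z, ~ B z & p = colon B z]) /\
    forall f, (forall p, p \in ps -> ~ p f) -> regular f A B.
Proof.
move=> iA iB.
pose top y := [/\ A y, ~ B y & forall y', A y' -> ~ B y' ->
  colon B y `<=` colon B y' -> colon B y' `<=` colon B y].
have top_prime y : top y -> prime_ideal (colon B y).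
  case=> Ay nBy ymax; split; [exact: ideal_colon|by rewrite /colon /= mul1r|].
  move=> a b; rewrite /colon /= -mulrA => Baby.
  have [|nBby] := pselect (B (b * y)); [by right|left].
  apply: (ymax (b * y)) => //; first exact: ideal_M.
  by move=> c; rewrite /colon /= mulrCA; exact: ideal_M.
have top_above z : A z -> ~ B z -> exists2 y, top y & colon B z `<=` colon B y.
  move=> Az nBz.
  have [||_ [[y [Ay nBy zy ->]] ymax]] := noethR
      (F := [set I | exists y, [/\ A y, ~ B y, colon B z `<=` colon B y & I = colon B y]]).
  - by move=> _ [y [_ _ _ ->]]; exact: ideal_colon.
  - by exists (colon B z), z; split=> // x.
  exists y => //; split=> // y' Ay' nBy' yy'; apply: ymax => //.
  by exists y'; split=> //; exact: subset_trans yy'.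
(* [gen zs] is the submodule generated by [zs], as an ideal containing [B]. *)
pose gen := fix gen zs := if zs is z :: zs' then
  [set x | exists r, gen zs' (x - r * z)] else B.
have gen_ideal zs : is_ideal (gen zs).
  elim: zs => //= z zs ih; split=> [|a b [r ar] [t bt]|c a [r ar]].
  - by exists 0; rewrite mul0r subr0; exact: ideal_0.
  - by exists (r + t); rewrite mulrDl opprD addrACA; exact: ideal_D.
  - by exists (c * r); rewrite -mulrA -mulrBr; exact: ideal_M.
have gen_min zs I : is_ideal I -> B `<=` I -> (forall z, z \in zs -> I z) -> gen zs `<=` I.
  move=> iI BI; elim: zs => //= z zs ih zI x [r /ih xr].
  rewrite -(subrK (r * z) x); apply: ideal_D => //.
    by apply: xr => y yz; apply: zI; rewrite inE yz orbT.
  by apply: ideal_M => //; apply: zI; rewrite mem_head.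
have [||_ [[zs zsP ->] zs_max]] := noethR
    (F := [set I | exists2 zs, (forall z, z \in zs -> top z) & I = gen zs]).
- by move=> _ [zs _ ->].
- by exists B, [::].
have gen_top z : top z -> gen zs z.
  move=> tz; apply: (zs_max (gen (z :: zs))).
  - by exists (z :: zs) => // y; rewrite inE => /orP[/eqP->|/zsP].
  - by move=> x zx /=; exists 0; rewrite mul0r subr0.
  - by exists 1; rewrite mul1r subrr; exact: ideal_0.
exists [seq colon B z | z <- zs]; split.
  move=> _ /mapP[z zz ->]; have tz := zsP z zz; split; first exact: top_prime.
  by case: tz => Az nBz _; exists z.
move=> f fP z Az Bfz; apply: contrapT => nBz.
have [y ty zy] := top_above z Az nBz.
suff [x xz yx] : exists2 x, x \in zs & colon B y `<=` colon B x.
  by apply: (fP (colon B x)); [exact: map_f|exact/yx/zy].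
suff [x xz xy] : exists2 x, x \in zs & colon B x `<=` colon B y.
  exists x => //; have [_ _ xmax] := zsP x xz; apply: xmax => //.
    by case: ty.
  by case: ty.
apply: contrapT => nsub.
have py := top_prime y ty; have [ipy p1 _] := py.
have [|r [nr rP]] := @prime_avoid_mul _ (colon B) zs (colon B y) 1 py p1.
  by move=> x xz; split; [exact: ideal_colon|move=> xy; apply: nsub; exists x].
rewrite mulr1 in nr rP; apply: nr.
have icol : is_ideal [set x | B (r * x)].
  have := ideal_colon r iB; rewrite /colon.
  by under [X in is_ideal X]eq_set => x do rewrite mulrC.
apply: (gen_min zs _ icol _ rP y (gen_top y ty)).
by move=> x /=; exact: ideal_M.
Qed.

Lemma avoiding_primes m A B : is_ideal A -> is_ideal B -> socle_free m A B ->
  exists ps : seq (set R), (forall p, p \in ps -> prime_ideal p /\ ~ m `<=` p) /\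
    forall f, (forall p, p \in ps -> ~ p f) -> regular f A B.
Proof.
move=> iA iB sf; have [ps [psP reg]] := finite_associated_primes iA iB.
exists ps; split=> // p /psP[pp [z [Az nBz pE]]]; split=> // mp; apply: nBz.
by apply: sf => // f /mp; rewrite pE.
Qed.

Variable m : set R.
Hypothesis idm : is_ideal m.

Lemma exists_regular3 A1 B1 A2 B2 A3 B3 :
  is_ideal A1 -> is_ideal B1 -> is_ideal A2 -> is_ideal B2 -> is_ideal A3 -> is_ideal B3 ->
  socle_free m A1 B1 -> socle_free m A2 B2 -> socle_free m A3 B3 ->
  exists2 f, m f & [/\ regular f A1 B1, regular f A2 B2 & regular f A3 B3].
Proof.
move=> iA1 iB1 iA2 iB2 iA3 iB3 s1 s2 s3.
have [p1 [pp1 r1]] := avoiding_primes iA1 iB1 s1.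
have [p2 [pp2 r2]] := avoiding_primes iA2 iB2 s2.
have [p3 [pp3 r3]] := avoiding_primes iA3 iB3 s3.
have [|f mf fP] := @prime_avoidance m (p1 ++ p2 ++ p3) idm.
  by move=> p; rewrite !mem_cat => /or3P[/pp1|/pp2|/pp3].
exists f => //; split; [apply: r1|apply: r2|apply: r3] => p pin; apply: fP;
  by rewrite !mem_cat pin ?orbT.
Qed.

(** ** Depth does not depend on the choice of the regular sequence *)

(** The last quotient may be zero, so that zero modules need no separate treatment
    in the arguments with exact sequences; for the modules of interest Nakayama's
    lemma shows that it is nonzero. *)
Fixpoint depth_ge d A B : Prop :=
  if d is d'.+1 then exists f, [/\ m f, regular f A B & depth_ge d' A (addmul B f A)]
  else True.

Lemma depth_geS d A B : depth_ge d.+1 A B -> depth_ge d A B.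
Proof.
elim: d B => // d ih B [f [mf rf dB]]; exists f; split=> //.
exact: ih.
Qed.

Lemma depth_ge_leq d e A B : (d <= e)%N -> depth_ge e A B -> depth_ge d A B.
Proof.
elim: e => [|e ih]; first by rewrite leqn0 => /eqP->.
by rewrite leq_eqVlt => /orP[/eqP->//|/ih h /depth_geS].
Qed.

Lemma depth_ge_socle d A B : depth_ge d.+1 A B -> socle_free m A B.
Proof. by case=> f [mf rf _] z Az mz; apply: rf => //; exact: mz. Qed.

Lemma socle_depth_ge A B : is_ideal A -> is_ideal B ->
  socle_free m A B -> depth_ge 1 A B.
Proof.
move=> iA iB sf; have [f mf [rf _ _]] := exists_regular3 iA iB iA iB iA iB sf sf sf.
by exists f.
Qed.

(** The theorem of Rees.  By induction it suffices to go from the given first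
    element [f] to [g] through an element [h] that is regular modulo both. *)
Lemma depth_ge_quotient d A B g : is_ideal A -> is_ideal B -> m g ->
  depth_ge d.+1 A B -> regular g A B -> depth_ge d A (addmul B g A).
Proof.
move=> iA; elim: d B g => // d ih B g iB mg [f [mf rf df]] rg.
have iBf := ideal_addmul f iA iB; have iBg := ideal_addmul g iA iB.
have sBf := depth_ge_socle df.
have sBg := socle_free_exchange iA iB mf rf rg sBf.
have sB : socle_free m A B by move=> z Az mz; apply: rf => //; exact: mz.
have [h mh [rh rhf rhg]] := exists_regular3 iA iB iA iBf iA iBg sB sBf sBg.
have dh : depth_ge d.+1 A (addmul B h A).
  exists f; split=> //; first exact: regular_swap.
  by rewrite addmulC; exact: ih.
exists h; split=> //; rewrite addmulC.
apply: ih => //; [exact: ideal_addmul|exact: regular_swap].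
Qed.

(** [A / B] and [A' / B'] are identified by the inclusion of [A] into [A']. *)
Definition same_quotient A B A' B' : Prop :=
  [/\ A `<=` A', B' `<=` A', forall x, A' x -> exists2 a, A a & B' (x - a)
    & forall x, A x -> (B x <-> B' x)].

Lemma same_quotient_regular f A B A' B' : is_ideal A -> is_ideal B' ->
  same_quotient A B A' B' -> regular f A B <-> regular f A' B'.
Proof.
move=> iA iB' [AA BA A'A BB]; split=> rf g.
  move=> /A'A[a Aa B'g] B'fg; rewrite -(subrK a g); apply: ideal_D => //.
  apply/BB => //; apply: rf => //; apply/BB; first exact: ideal_M.
  rewrite -[f * a](subKr (f * g)) -mulrBr; apply: ideal_B => //.
  exact: ideal_M.
move=> Ag /BB h; apply/BB => //; apply: rf; first exact: AA.
by apply: h; exact: ideal_M.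
Qed.

Lemma same_quotient_addmul f A B A' B' : is_ideal A -> is_ideal A' -> is_ideal B' ->
  same_quotient A B A' B' -> same_quotient A (addmul B f A) A' (addmul B' f A').
Proof.
move=> iA iA' iB' [AA BA A'A BB]; split=> //.
- exact: addmul_min.
- by move=> x /A'A[a Aa Bx]; exists a => //; exact: addmul_incl.
- move=> x Ax; split=> /addmulP[a [Aa xa]]; apply/addmulP.
    exists a; split; first exact: AA.
    by apply/BB => //; apply: ideal_B => //; exact: ideal_M.
  have [a' Aa' aa'] := A'A a Aa; exists a'; split=> //; apply/BB.
    by apply: ideal_B => //; exact: ideal_M.
  have -> : x - f * a' = (x - f * a) + f * (a - a') by ring.
  by apply: ideal_D => //; exact: ideal_M.
Qed.

Lemma same_quotient_depth_ge d A B A' B' : is_ideal A -> is_ideal A' -> is_ideal B' ->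
  same_quotient A B A' B' -> depth_ge d A B <-> depth_ge d A' B'.
Proof.
move=> iA iA'; elim: d B B' => // d ih B B' iB' sq.
split=> -[f [mf rf df]]; exists f; split=> //.
- exact/(same_quotient_regular f iA iB' sq).
- exact/(ih _ _ (ideal_addmul f iA' iB') (same_quotient_addmul f iA iA' iB' sq)).
- exact/(same_quotient_regular f iA iB' sq).
- exact/(ih _ _ (ideal_addmul f iA' iB') (same_quotient_addmul f iA iA' iB' sq)).
Qed.

(** For [f] regular on [A / B], reduction modulo [f] keeps
    [0 -> B / C -> A / C -> A / B -> 0] exact. *)
Lemma same_quotient_sub f A B C : is_ideal A -> is_ideal B -> is_ideal C ->
  C `<=` B -> B `<=` A -> regular f A B ->
  same_quotient B (addmul C f B) (addmul B f A) (addmul C f A).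
Proof.
move=> iA iB iC CB BA rf; split.
- exact: addmul_incl.
- exact: addmulS.
- move=> x /addmulP[a [Aa Bx]]; exists (x - f * a) => //.
  by rewrite subKr; exact: addmul_mul.
- move=> x Bx; split; first exact: addmulS.
  case/addmulP=> a [Aa Cx]; apply/addmulP; exists a; split=> //; apply: rf => //.
  by rewrite -(subKr x (f * a)); apply: ideal_B => //; exact: CB.
Qed.

(** Induction on [d], reducing the three modules modulo an element that is regular on
    all of them. *)
Lemma depth_ge_sub d A B C : is_ideal A -> is_ideal B -> is_ideal C ->
  C `<=` B -> B `<=` A ->
  depth_ge d.+1 A C -> depth_ge d A B -> depth_ge d.+1 B C.
Proof.
move=> iA; elim: d B C => [|d ih] B C iB iC CB BA dAC dAB.
  have [f [mf rf _]] := dAC; exists f; split=> // g /BA Ag; exact: rf.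
have sAC := depth_ge_socle dAC; have sAB := depth_ge_socle dAB.
have [f mf [rAC _ rAB]] := exists_regular3 iA iC iA iC iA iB sAC sAC sAB.
exists f; split=> //; first by move=> g /BA Ag; exact: rAC.
have iBf := ideal_addmul f iA iB; have iCf := ideal_addmul f iA iC.
apply/(same_quotient_depth_ge _ iB iBf iCf (same_quotient_sub iA iB iC CB BA rAB)).
apply: ih => //; [exact: addmulS|exact: addmul_min|exact: depth_ge_quotient|].
exact: depth_ge_quotient.
Qed.

(** As for [depth_ge_sub], once [A / B] is known to have no socle: if [z] represents a
    socle element, then [f * z] represents one of [B / (C + f B)], which has
    positive depth. *)
Lemma depth_ge_quo d A B C : is_ideal A -> is_ideal B -> is_ideal C ->
  C `<=` B -> B `<=` A ->
  depth_ge d.+1 B C -> depth_ge d A C -> depth_ge d A B.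
Proof.
move=> iA; elim: d B C => // d ih B C iB iC CB BA dBC dAC.
have sBC := depth_ge_socle dBC; have sAC := depth_ge_socle dAC.
have sAB : socle_free m A B.
  move=> z Az mz; have [f mf [rBC rAC _]] := exists_regular3 iB iC iA iC iA iC sBC sAC sAC.
  have /depth_ge_socle sf := depth_ge_quotient iB iC mf dBC rBC.
  have /addmulP[b [Bb Cb]] : addmul C f B (f * z).
    apply: sf; first exact: mz.
    by move=> t /mz Btz; rewrite mulrCA; exact: addmul_mul.
  rewrite -(subrK b z); apply: ideal_D => //; apply: CB; apply: rAC.
    by apply: ideal_B => //; exact: BA.
  by rewrite mulrBr.
have [f mf [rBC rAC rAB]] := exists_regular3 iB iC iA iC iA iB sBC sAC sAB.
exists f; split=> //.
have iBf := ideal_addmul f iA iB; have iCf := ideal_addmul f iA iC.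
apply: (ih _ (addmul C f A)) => //; [exact: addmulS|exact: addmul_min| |].
  apply/(same_quotient_depth_ge _ iB iBf iCf (same_quotient_sub iA iB iC CB BA rAB)).
  exact: depth_ge_quotient.
exact: depth_ge_quotient.
Qed.

End RegularSequences.
(** * Monomial ideals as sets of exponent vectors *)

Section MonomialIdeals.
Context {K : fieldType} {n : nat}.
Implicit Types (P Q : set 'X_{1..n}) (u w : 'X_{1..n}) (f : {mpoly K[n]}).

Definition mset P : set {mpoly K[n]} := [set f | forall u, u \in msupp f -> P u].

Lemma msetX P u : mset P 'X_[u] <-> P u.
Proof. by split=> [|Pu v]; [apply; rewrite msuppX mem_head|rewrite msuppX inE => /eqP->]. Qed.

Lemma msetP P f : mset P f <-> forall u, f@_u != 0 -> P u.
Proof. by split=> h u; [rewrite -mcoeff_msupp|rewrite mcoeff_msupp]; exact: h. Qed.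

Lemma mset0 P : mset P 0.
Proof. by apply/msetP => u; rewrite mcoeff0 eqxx. Qed.

Lemma msetD P f g : mset P f -> mset P g -> mset P (f + g).
Proof. by move=> Pf Pg u /msuppD_le; rewrite mem_cat => /orP[/Pf|/Pg]. Qed.

Lemma msetZ P c f : mset P f -> mset P (c *: f).
Proof. by move=> Pf u /msuppZ_le/Pf. Qed.

Lemma msetN P f : mset P f -> mset P (- f).
Proof. by rewrite -scaleN1r; exact: msetZ. Qed.

Lemma msetB P f g : mset P f -> mset P g -> mset P (f - g).
Proof. by move=> Pf Pg; apply: msetD => //; exact: msetN. Qed.

Lemma mset_sum P (J : Type) (s : seq J) (p : pred J) (F : J -> {mpoly K[n]}) :
  (forall i, p i -> mset P (F i)) -> mset P (\sum_(i <- s | p i) F i).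
Proof.
by move=> PF; apply: (big_ind (mset P)) => //; [exact: mset0|exact: msetD].
Qed.

Lemma msetS P Q : P `<=` Q -> mset P `<=` mset Q.
Proof. by move=> PQ f Pf u /Pf/PQ. Qed.

Lemma ideal_mset P : upset P -> is_ideal (mset P).
Proof.
move=> upP; split; [exact: mset0|exact: msetD|move=> g f Pf u].
move=> /msuppM_le/allpairsP[[v w] [/= _ wf ->]].
by apply: upP (Pf _ wf); exact: lem_addl.
Qed.

Lemma mset_subset P A : is_ideal A -> (forall u, P u -> A 'X_[u]) -> mset P `<=` A.
Proof.
move=> iA PA f Pf; rewrite (mpolyE f) big_seq; apply: ideal_sum => // u /Pf/PA Au.
by rewrite -mul_mpolyC; exact: ideal_M.
Qed.

Lemma monomial_ideal_mset (I : set {mpoly K[n]}) :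
  monomial_ideal I -> exists2 P, upset P & I = mset P.
Proof.
move=> [U ->]; pose P : set 'X_{1..n} := [set w | exists2 u, U u & (u <= w)%MM].
have upP : upset P by move=> u w uw [x Ux xu]; exists x => //; exact: lepm_trans uw.
exists P => //; rewrite eqEsubset; split.
  apply: ideal_span_min; first exact: ideal_mset.
  by move=> _ [u Uu <-]; apply/msetX; exists u => //; exact: lepm_refl.
have iU := ideal_ideal_span [set 'X_[K, u] | u in U].
apply: mset_subset => // w [u Uu uw].
rewrite -(submK uw) mpolyXD; apply: ideal_M => //.
by apply: ideal_span_incl; exists u.
Qed.

Lemma zero_ideal_mset : zero_ideal = mset set0.
Proof.
rewrite eqEsubset; split=> f; first by move->; exact: mset0.
move=> h; apply/mpolyP => u; rewrite mcoeff0; apply/eqP; apply: contrapT => /negP.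
by rewrite -mcoeff_msupp => /h.
Qed.

Lemma setT_mset : setT = mset setT :> set {mpoly K[n]}.
Proof. by rewrite eqEsubset. Qed.

Lemma mset_setI P Q : mset P `&` mset Q = mset (P `&` Q).
Proof.
rewrite eqEsubset; split=> f; first by case=> Pf Qf u uf; split; [exact: Pf|exact: Qf].
by move=> h; split; apply: (msetS _ h) => u [].
Qed.

Lemma mset_idealD P Q : idealD (mset P) (mset Q) = mset (P `|` Q).
Proof.
rewrite eqEsubset; split=> f.
  by case=> g Pg [h Qh <-]; apply: msetD;
    [apply: (msetS _ Pg)|apply: (msetS _ Qh)] => u; [left|right].
move=> h; rewrite (mpolyE f) (bigID (fun u => `[<P u>])) /=.
exists (\sum_(u <- msupp f | `[<P u>]) f@_u *: 'X_[u]).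
  by apply: mset_sum => u /asboolP Pu; apply: msetZ; exact/msetX.
eexists; last by [].
rewrite big_seq_cond; apply: mset_sum => u /andP[/h[Pu|Qu] /asboolPn nPu] //.
by apply: msetZ; exact/msetX.
Qed.

Lemma mset_neqT P : upset P -> mset P <> setT <-> ~ P 0%MM.
Proof.
move=> upP; split=> [nT P0|nP0 PT]; last first.
  by apply: nP0; apply/(@msetX P); rewrite PT.
apply: nT; rewrite eqEsubset; split=> // f _ u _.
by apply: upP P0; apply/mnm_lepP => i; rewrite mnm0E.
Qed.

Lemma mset_neq0 P : mset P <> zero_ideal <-> exists u, P u.
Proof.
split=> [n0|[u Pu] P0]; last first.
  have /msetX := Pu; rewrite P0 => /eqP.
  by rewrite -msize_poly_eq0 msizeX.
apply: contrapT => nP; apply: n0; rewrite zero_ideal_mset eqEsubset.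
by split; apply: msetS => // u Pu; apply: nP; exists u.
Qed.

End MonomialIdeals.

Lemma upset_setU n (P Q : set 'X_{1..n}) : upset P -> upset Q -> upset (P `|` Q).
Proof. by move=> uP uQ u w uw [/(uP _ _ uw)|/(uQ _ _ uw)]; [left|right]. Qed.

Lemma upset_setI n (P Q : set 'X_{1..n}) : upset P -> upset Q -> upset (P `&` Q).
Proof. by move=> uP uQ u w uw [/(uP _ _ uw) ? /(uQ _ _ uw)]. Qed.

(* [upset] unfolds to a product, whose variables are not to become implicit. *)
Arguments upset_setU {n P Q} _ _ u w.
Arguments upset_setI {n P Q} _ _ u w.

(** ** Two groups of variables *)

Section TwoGroups.
Context {r s : nat}.
Implicit Types (u : 'X_{1..r}) (v : 'X_{1..s}) (w : 'X_{1..r + s}).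

Definition mcat u v : 'X_{1..r + s} :=
  [multinom match split i with inl j => u j | inr j => v j end | i < r + s].
Definition mleft w : 'X_{1..r} := [multinom w (lshift s i) | i < r].
Definition mright w : 'X_{1..s} := [multinom w (rshift r i) | i < s].

Lemma mcatl u v i : mcat u v (lshift s i) = u i.
Proof. by rewrite mnmE (unsplitK (inl i)). Qed.

Lemma mcatr u v i : mcat u v (rshift r i) = v i.
Proof. by rewrite mnmE (unsplitK (inr i)). Qed.

Lemma mleft_mcat u v : mleft (mcat u v) = u.
Proof. by apply/mnmP => i; rewrite mnmE mcatl. Qed.

Lemma mright_mcat u v : mright (mcat u v) = v.
Proof. by apply/mnmP => i; rewrite mnmE mcatr. Qed.

Lemma mcatP w w' : mleft w = mleft w' -> mright w = mright w' -> w = w'.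
Proof.
move=> /mnmP lE /mnmP rE; apply/mnmP => i; rewrite -(splitK i).
case: split => j /=; [have := lE j|have := rE j]; by rewrite !mnmE.
Qed.

Lemma mcatK w : mcat (mleft w) (mright w) = w.
Proof. by apply: mcatP; rewrite ?mleft_mcat ?mright_mcat. Qed.

Lemma mleft_le w w' : (w <= w')%MM -> (mleft w <= mleft w')%MM.
Proof. by move=> /mnm_lepP h; apply/mnm_lepP => i; rewrite !mnmE. Qed.

Lemma mright_le w w' : (w <= w')%MM -> (mright w <= mright w')%MM.
Proof. by move=> /mnm_lepP h; apply/mnm_lepP => i; rewrite !mnmE. Qed.

Lemma mcat_add u v u' v' : (mcat u v + mcat u' v' = mcat (u + u') (v + v'))%MM.
Proof. by apply/mnmP => i; rewrite !mnmE; case: split => j; rewrite mnmE. Qed.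

Lemma mcat_split u v : mcat u v = (mcat u 0 + mcat 0 v)%MM.
Proof. by rewrite mcat_add addm0 add0m. Qed.

Definition pre_left (P : set 'X_{1..r}) : set 'X_{1..r + s} := [set w | P (mleft w)].
Definition pre_right (Q : set 'X_{1..s}) : set 'X_{1..r + s} := [set w | Q (mright w)].

Lemma upset_pre_left P : upset P -> upset (pre_left P).
Proof. by move=> uP w w' /mleft_le; exact: uP. Qed.

Lemma upset_pre_right Q : upset Q -> upset (pre_right Q).
Proof. by move=> uQ w w' /mright_le; exact: uQ. Qed.

Arguments upset_pre_left {P} _ u w.
Arguments upset_pre_right {Q} _ u w.

Context {K : fieldType}.

Lemma rename_lshiftX u : rename_vars (lshift s) 'X_[K, u] = 'X_[mcat u 0].
Proof.
rewrite /rename_vars comp_mpolyX.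
under eq_bigr => i _ do rewrite tnth_mktuple.
rewrite mprodXnE; congr 'X_[_]; apply/mnmP => i; rewrite mnm_sumE -(splitK i).
under eq_bigr => j _ do rewrite mulmnE mnm1E.
case: split => j /=; rewrite ?mcatl ?mcatr.
  rewrite (bigD1 j) //= eqxx mul1n big1 ?addn0 // => k kj.
  by rewrite (inj_eq (@lshift_inj _ _)) (negbTE kj).
by rewrite mnm0E big1 // => k _; rewrite eq_lrshift.
Qed.

Lemma rename_rshiftX v : rename_vars (@rshift r s) 'X_[K, v] = 'X_[mcat 0 v].
Proof.
rewrite /rename_vars comp_mpolyX.
under eq_bigr => i _ do rewrite tnth_mktuple.
rewrite mprodXnE; congr 'X_[_]; apply/mnmP => i; rewrite mnm_sumE -(splitK i).
under eq_bigr => j _ do rewrite mulmnE mnm1E.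
case: split => j /=; rewrite ?mcatl ?mcatr.
  by rewrite mnm0E big1 // => k _; rewrite eq_rlshift.
rewrite (bigD1 j) //= eqxx mul1n big1 ?addn0 // => k kj.
by rewrite (inj_eq (@rshift_inj _ _)) (negbTE kj).
Qed.

Lemma rename_varsE k n (h : 'I_k -> 'I_n) (p : {mpoly K[k]}) :
  rename_vars h p = \sum_(u <- msupp p) p@_u *: rename_vars h 'X_[u].
Proof. by rewrite /rename_vars comp_mpolyEX. Qed.

Lemma extl_mset (P : set 'X_{1..r}) : upset P ->
  extl (mset P) = mset (pre_left P) :> set {mpoly K[r + s]}.
Proof.
move=> uP; rewrite eqEsubset; split.
  apply: ideal_span_min; first exact/ideal_mset/upset_pre_left.
  move=> _ [f Pf <-]; rewrite rename_varsE big_seq; apply: mset_sum => u /Pf Pu.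
  by apply: msetZ; rewrite rename_lshiftX; apply/msetX; rewrite /pre_left /= mleft_mcat.
apply: mset_subset => [|w Pw]; first exact: ideal_ideal_span.
rewrite -(mcatK w) mcat_split mpolyXD; apply: ideal_Mr; first exact: ideal_ideal_span.
apply: ideal_span_incl; exists 'X_[mleft w]; first exact/msetX.
exact: rename_lshiftX.
Qed.

Lemma extr_mset (Q : set 'X_{1..s}) : upset Q ->
  extr (mset Q) = mset (pre_right Q) :> set {mpoly K[r + s]}.
Proof.
move=> uQ; rewrite eqEsubset; split.
  apply: ideal_span_min; first exact/ideal_mset/upset_pre_right.
  move=> _ [f Qf <-]; rewrite rename_varsE big_seq; apply: mset_sum => v /Qf Qv.
  by apply: msetZ; rewrite rename_rshiftX; apply/msetX; rewrite /pre_right /= mright_mcat.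
apply: mset_subset => [|w Qw]; first exact: ideal_ideal_span.
rewrite -(mcatK w) mcat_split mpolyXD; apply: ideal_M; first exact: ideal_ideal_span.
apply: ideal_span_incl; exists 'X_[mright w]; first exact/msetX.
exact: rename_rshiftX.
Qed.

End TwoGroups.
Arguments upset_pre_left {r s P} _ u w.
Arguments upset_pre_right {r s Q} _ u w.

(** * Stanley decompositions as partitions into cones *)

Definition cone n (u : 'X_{1..n}) (Z : {set 'I_n}) (w : 'X_{1..n}) : bool :=
  [forall i, if i \in Z then (u i <= w i)%N else w i == u i].

Lemma coneP n (u : 'X_{1..n}) (Z : {set 'I_n}) w :
  reflect ((u <= w)%MM /\ forall i, i \notin Z -> w i = u i) (cone u Z w).
Proof.
apply: (iffP forallP) => [h|[/mnm_lepP uw wu] i].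
  split=> [|i iZ]; last by have := h i; rewrite (negbTE iZ) => /eqP.
  by apply/mnm_lepP => i; have := h i; case: ifP => // _ /eqP->.
by case: ifPn => [_|/wu->]; [exact: uw|exact: eqxx].
Qed.

Definition cone_partition n (D : set 'X_{1..n}) (J : Type)
    (u : J -> 'X_{1..n}) (Z : J -> {set 'I_n}) : Prop :=
  [/\ forall j w, cone (u j) (Z j) w -> D w,
      forall w, D w -> exists j, cone (u j) (Z j) w
    & forall i j w, cone (u i) (Z i) w -> cone (u j) (Z j) w -> i = j].

Definition cone_depth_ge n (D : set 'X_{1..n}) (d : nat) : Prop :=
  exists (J : finType) (u : J -> 'X_{1..n}) (Z : J -> {set 'I_n}),
    cone_partition D u Z /\ forall j, (d <= #|Z j|)%N.

Section StanleyCones.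
Context {K : fieldType} {n : nat}.
Implicit Types (P Q D : set 'X_{1..n}) (w : 'X_{1..n}).

Lemma subpolyring_addP (Z : {set 'I_n}) u (f : {mpoly K[n]}) : subpolyring Z f <->
  forall v, v \in msupp f -> cone u Z (u + v)%MM.
Proof.
split=> h v /h; last first.
  by move=> /coneP[_ vu] i /vu; rewrite mnmDE => /eqP; rewrite -{2}[u i]addn0 eqn_add2l => /eqP.
by move=> vZ; apply/coneP; split=> [|i /vZ]; [exact: lem_addr|rewrite mnmDE => ->; rewrite addn0].
Qed.

Lemma cone_subpolyringX Z u w : cone u Z w -> subpolyring Z ('X_[w - u] : {mpoly K[n]}).
Proof.
move=> cw; have /coneP[uw _] := cw; apply/(subpolyring_addP _ u) => v.
by rewrite msuppX inE => /eqP->; rewrite addmC submK.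
Qed.

Lemma mcoeffXM u (g : {mpoly K[n]}) w :
  ('X_[u] * g)@_w = if (u <= w)%MM then g@_(w - u) else 0.
Proof.
case: ifPn => [uw|nuw]; first by rewrite -{1}(submK uw) mulrC addmC mcoeffMX.
apply/eqP; rewrite mcoeff_eq0; apply: contra nuw => /msuppM_le/allpairsP[[a b] [/=]].
by rewrite msuppX inE => /eqP-> _ ->; exact: lem_addr.
Qed.

Lemma mcoeff_cone Z u (g : {mpoly K[n]}) w : subpolyring Z g ->
  ('X_[u] * g)@_w != 0 -> cone u Z w.
Proof.
move=> /(subpolyring_addP _ u) gZ; rewrite mcoeffXM; case: ifP => [uw|]; last by rewrite eqxx.
by rewrite -mcoeff_msupp => /gZ; rewrite addmC submK.
Qed.

(** The generators are multiples of monomials, whose exponents are the apices of the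
    cones.  Two cones with a common exponent [w] would contradict directness, as
    both summands contain the monomial with exponent [w]. *)
Lemma Stanley_decomposition_cones P Q t (m : 'I_t -> {mpoly K[n]})
    (Z : 'I_t -> {set 'I_n}) :
  upset P -> Stanley_decomposition (mset P) (mset Q) m Z ->
  exists u : 'I_t -> 'X_{1..n}, cone_partition (P `\` Q) u Z.
Proof.
move=> upP [hom mP free span dir].
have [c cP] := choice hom; have [u uP] := choice cP.
have c0 i : c i != 0.
  apply/eqP => ci0; have sub1 : subpolyring (Z i) (1 : {mpoly K[n]}).
    by move=> w; rewrite msupp1 inE => /eqP-> j _; rewrite mnm0E.
  have := free i 1 sub1; rewrite uP ci0 scale0r mul0r => /(_ (mset0 _))/eqP.
  by rewrite oner_eq0.
have mE i w : cone (u i) (Z i) w -> m i * ((c i)^-1 *: 'X_[w - u i]) = 'X_[w].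
  move=> /coneP[uw _].
  by rewrite uP -scalerAl -scalerAr scalerA divff // scale1r -mpolyXD addmC submK.
have subZ i w a : cone (u i) (Z i) w -> subpolyring (Z i) (a *: 'X_[w - u i] : {mpoly K[n]}).
  by move=> /cone_subpolyringX h v /msuppZ_le; exact: h.
have inD i w : cone (u i) (Z i) w -> (P `\` Q) w.
  move=> cw; split.
    have /coneP[uw _] := cw; apply: upP uw _.
    move: (mP i); rewrite uP => /(@msetZ _ _ _ (c i)^-1 _).
    by rewrite scalerA mulVf // scale1r => /msetX.
  move=> Qw; have := free i _ (subZ i w (c i)^-1 cw).
  rewrite mE // => /(_ ((msetX Q w).2 Qw))/eqP.
  rewrite scaler_eq0 invr_eq0 (negbTE (c0 i)) /=.
  by rewrite -msize_poly_eq0 msizeX.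
exists u; split=> //.
- move=> w [Pw nQw]; have [g [gZ Bg]] := span _ ((msetX P w).2 Pw).
  have : ('X_[w] - \sum_(i < t) m i * g i)@_w == 0.
    by apply: contrapT => /negP; rewrite -mcoeff_msupp => /Bg.
  rewrite mcoeffB mcoeffX eqxx subr_eq0 raddf_sum /=.
  have [[i /(mcoeff_cone (gZ i)) wi] _|none] := pselect (exists i, ('X_[u i] * g i)@_w != 0).
    by exists i.
  rewrite big1 ?oner_eq0 // => i _; rewrite uP -scalerAl mcoeffZ.
  have [->|h] := eqVneq (('X_[u i] * g i)@_w) 0; first by rewrite mulr0.
  by case: none; exists i.
- move=> i j w ci cj; apply: contrapT => /eqP nij; have [_ nQw] := inD i w ci.
  pose g k : {mpoly K[n]} := if k == i then (c i)^-1 *: 'X_[w - u i] else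
    if k == j then - ((c j)^-1 *: 'X_[w - u j]) else 0.
  have gZ k : subpolyring (Z k) (g k).
    rewrite /g; case: eqP => [->|_]; first exact: subZ.
    case: eqP => [->|_]; last by move=> v; rewrite msupp0.
    by rewrite -scaleNr; exact: subZ.
  have sum0 : \sum_k m k * g k = 0.
    rewrite (bigD1 i) //= (bigD1 j) 1?eq_sym //= big1 => [|k /andP[ki kj]].
      by rewrite /g eqxx [j == i]eq_sym (negbTE nij) eqxx mulrN !mE // addr0 subrr.
    by rewrite /g (negbTE ki) (negbTE kj) mulr0.
  have := dir g gZ; rewrite sum0 => /(_ (mset0 _) i).
  by rewrite /g eqxx mE // => /msetX.
Qed.

Lemma cones_Stanley_decomposition P Q t (u : 'I_t -> 'X_{1..n})
    (Z : 'I_t -> {set 'I_n}) :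
  cone_partition (P `\` Q) u Z ->
  Stanley_decomposition (mset P) (mset Q) (fun i => 'X_[u i] : {mpoly K[n]}) Z.
Proof.
move=> [inD cov disj].
have cone_self i : cone (u i) (Z i) (u i) by apply/coneP; split=> //; exact: lepm_refl.
split.
- by move=> i; exists 1, (u i); rewrite scale1r.
- by move=> i; apply/msetX; case: (inD i _ (cone_self i)).
- move=> i f fZ Bf; apply/mpolyP => v; rewrite mcoeff0; apply/eqP; apply: contrapT => /negP nz.
  have cv : cone (u i) (Z i) (u i + v)%MM.
    by apply/((subpolyring_addP _ (u i) f).1 fZ); rewrite mcoeff_msupp.
  have [_ []] := inD _ _ cv; apply: Bf.
  by rewrite mcoeff_msupp mcoeffXM lem_addr addmC addmK.
- move=> f Pf.
  pose g i : {mpoly K[n]} := \sum_(w <- msupp f | cone (u i) (Z i) w) f@_w *: 'X_[w - u i].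
  have gE i : 'X_[u i] * g i = \sum_(w <- msupp f | cone (u i) (Z i) w) f@_w *: 'X_[w].
    rewrite mulr_sumr; apply: eq_bigr => w /coneP[uw _].
    by rewrite -scalerAr -mpolyXD addmC submK.
  exists g; split.
    move=> i; apply/(subpolyring_addP _ (u i)) => v /msupp_sum_le/flattenP[q /mapP[w]].
    rewrite mem_filter => /andP[cw _] -> /msuppZ_le; rewrite msuppX inE => /eqP->.
    by have /coneP[uw _] := cw; rewrite addmC submK.
  rewrite (eq_bigr _ (fun i _ => gE i)) (exchange_big_dep xpredT) //=.
  rewrite {1}(mpolyE f) -sumrB big_seq; apply: mset_sum => w wf.
  have [Qw|nQw] := pselect (Q w).
    by apply: msetB; [|apply: mset_sum => i _]; apply: msetZ; apply/msetX.
  have [i ci] := cov w (conj (Pf w wf) nQw).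
  rewrite (big_pred1 i) ?subrr => [|j]; first exact: mset0.
  by apply/idP/eqP => [cj|-> //]; exact: disj cj ci.
- move=> g gZ Bg i; apply/msetP => w nz; apply: Bg; rewrite mcoeff_msupp raddf_sum /=.
  have ci := mcoeff_cone (gZ i) nz.
  rewrite (bigD1 i) //= big1 ?addr0 // => j nji; apply/eqP; apply: contrapT => /negP.
  by move=> /(mcoeff_cone (gZ j)) cj; move/eqP: nji; apply; exact: disj cj ci.
Qed.

Lemma cone_depth_ge_ord D d : cone_depth_ge D d ->
  exists t (u : 'I_t -> 'X_{1..n}) (Z : 'I_t -> {set 'I_n}),
    cone_partition D u Z /\ forall j, (d <= #|Z j|)%N.
Proof.
move=> [J [u [Z [[inD cov disj] dZ]]]].
exists #|J|, (u \o enum_val), (Z \o enum_val); split=> [|j]; last exact: dZ.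
split=> [j w|w /cov[j cj]|i j w ci cj]; first exact: inD.
  by exists (enum_rank j); rewrite /= enum_rankK.
exact/enum_val_inj/(disj _ _ w).
Qed.

Lemma leq_sdepth_dec t (Z : 'I_t -> {set 'I_n}) d :
  (d <= sdepth_dec Z)%N <-> (d <= n)%N /\ forall j, (d <= #|Z j|)%N.
Proof.
have -> : (d <= sdepth_dec Z)%N = (d <= n)%N && all (fun j => d <= #|Z j|)%N (index_enum 'I_t).
  rewrite /sdepth_dec; elim: (index_enum _) => [|j l ih]; first by rewrite big_nil andbT.
  by rewrite big_cons leq_min ih /= andbCA.
by split=> [/andP[-> /allP dZ]|[-> dZ]]; [split=> // j; exact: dZ (mem_index_enum j)|apply/allP].
Qed.

(** A cone for each truncated vector: an exponent that has reached the truncation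
    bound is free to grow. *)
Lemma cone_depth_ge0 P Q : upset P -> upset Q -> cone_depth_ge (P `\` Q) 0.
Proof.
move=> uP uQ; have [NP PN] := upset_trunc uP; have [NQ QN] := upset_trunc uQ.
pose N := maxn NP NQ; pose D := P `\` Q.
have DN w : D (mnm_trunc N w) <-> D w.
  split=> -[Pw nQw]; split.
  - exact: uP (mnm_trunc_le _ _) Pw.
  - by apply: contra_not nQw; apply: QN; exact: leq_maxr.
  - by apply: PN Pw; exact: leq_maxl.
  - by apply: contra_not nQw; apply: uQ; exact: mnm_trunc_le.
pose mk (c : {ffun 'I_n -> 'I_N.+1}) : 'X_{1..n} := [multinom c i : nat | i < n].
pose fr (c : {ffun 'I_n -> 'I_N.+1}) : {set 'I_n} := finset (fun i => c i == N :> nat).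
have cone_trunc c w : cone (mk c) (fr c) w <-> mnm_trunc N w = mk c.
  split=> [/coneP[/mnm_lepP cw wc]|/mnmP e].
    apply/mnmP => i; have := cw i; rewrite !mnmE => ci.
    have [iN|niN] := boolP (i \in fr c).
      by move: iN; rewrite inE => /eqP; lia.
    by rewrite (wc i niN) mnmE; have := ltn_ord (c i); lia.
  apply/coneP; split=> [|i]; first by apply/mnm_lepP => i; rewrite -(e i) mnmE geq_minl.
  by rewrite inE -[nat_of_ord _](mnmE (fun i => c i : nat)) -/(mk c) -e mnmE; lia.
exists {c : {ffun 'I_n -> 'I_N.+1} | `[<D (mk c)>]}, (fun c => mk (val c)), (fun c => fr (val c)).
split=> //; split.
- by move=> [c /= /asboolP Dc] w /cone_trunc wc; apply/DN; rewrite wc.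
- move=> w Dw; pose c := [ffun i : 'I_n => inord (mnm_trunc N w i) : 'I_N.+1].
  have cE : mk c = mnm_trunc N w.
    by apply/mnmP => i; rewrite mnmE ffunE inordK // mnmE ltnS geq_minr.
  have Dc : `[<D (mk c)>] by apply/asboolP; rewrite cE; apply/DN.
  by exists (exist _ c Dc); apply/cone_trunc.
- move=> [c Dc] [c' Dc'] w /= /cone_trunc e /cone_trunc e'; apply: val_inj => /=.
  apply/ffunP => i; apply: val_inj; have /mnmP/(_ i) : mk c = mk c' by rewrite -e.
  by rewrite !mnmE.
Qed.

Lemma sdepth_ubound (A B : set {mpoly K[n]}) :
  ubound [set d | exists t (m : 'I_t -> {mpoly K[n]}) (Z : 'I_t -> {set 'I_n}),
    Stanley_decomposition A B m Z /\ d = sdepth_dec Z] n.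
Proof. by move=> _ [t [m [Z [_ ->]]]]; case: (leq_sdepth_dec Z (sdepth_dec Z)).1. Qed.

Lemma leq_sdepth P Q d : (d <= n)%N -> cone_depth_ge (P `\` Q) d ->
  (d <= sdepth (mset P : set {mpoly K[n]}) (mset Q))%N.
Proof.
move=> dn /cone_depth_ge_ord[t [u [Z [part dZ]]]].
apply: (@leq_trans (sdepth_dec Z)); first exact/leq_sdepth_dec.
rewrite -leEnat; apply: ge_supremum_Nmem.
  by apply: nat_supremums_neq0; exists n; exact: sdepth_ubound.
by exists t, (fun i => 'X_[u i]), Z; split=> //; exact: cones_Stanley_decomposition.
Qed.

Lemma supremum_nat_mem (A : set nat) : A !=set0 -> ubound A !=set0 -> A (supremum 0%N A).
Proof.
move=> [a Aa] bA; have [y ysup] := nat_supremums_neq0 bA.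
rewrite /supremum ifN; last by apply/set0P; exists a.
case: xgetP => [b _ [ubA lbA]|/(_ y)//]; apply: contrapT => nAb.
have lt_b x : A x -> (x < b)%N.
  move=> Ax; have := ubA x Ax; rewrite leEnat leq_eqVlt => /orP[/eqP xb|//].
  by case: nAb; rewrite -xb.
have ub : ubound A b.-1 by move=> x /lt_b; rewrite leEnat; case: (b).
by have := lbA _ ub; have := lt_b a Aa; rewrite leEnat; case: (b) => //= c; rewrite ltnn.
Qed.

Lemma sdepth_cones P Q : upset P -> upset Q ->
  (sdepth (mset P : set {mpoly K[n]}) (mset Q) <= n)%N /\
  cone_depth_ge (P `\` Q) (sdepth (mset P : set {mpoly K[n]}) (mset Q)).
Proof.
move=> uP uQ; set S := sdepth _ _.
have [t [m [Z [dec SE]]]] : [set d | exists t (m : 'I_t -> {mpoly K[n]}) (Z : 'I_t -> {set 'I_n}),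
    Stanley_decomposition (mset P) (mset Q) m Z /\ d = sdepth_dec Z] S.
  apply: supremum_nat_mem; last by exists n; exact: sdepth_ubound.
  have [t [u [Z [part _]]]] := cone_depth_ge_ord (cone_depth_ge0 uP uQ).
  exists (sdepth_dec Z), t, (fun i => 'X_[u i]), Z; split=> //.
  exact: cones_Stanley_decomposition.
have [Sn dZ] := (leq_sdepth_dec Z S).1 (eq_leq SE).
have [u part] := Stanley_decomposition_cones uP dec.
by split=> //; exists 'I_t, u, Z.
Qed.

Lemma cone_depth_ge_union D1 D2 d1 d2 : D1 `&` D2 `<=` set0 ->
  cone_depth_ge D1 d1 -> cone_depth_ge D2 d2 ->
  cone_depth_ge (D1 `|` D2) (minn d1 d2).
Proof.
move=> D12 [J1 [u1 [Z1 [[in1 cov1 disj1] dZ1]]]] [J2 [u2 [Z2 [[in2 cov2 disj2] dZ2]]]].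
exists (J1 + J2)%type, (fun j => match j with inl j => u1 j | inr j => u2 j end),
  (fun j => match j with inl j => Z1 j | inr j => Z2 j end).
split=> [|[j|j]]; [|by rewrite geq_min dZ1|by rewrite geq_min dZ2 orbT].
split=> [[j|j] w|w [/cov1[j cj]|/cov2[j cj]]|].
- by move/in1; left.
- by move/in2; right.
- by exists (inl j).
- by exists (inr j).
- move=> [i|i] [j|j] w ci cj; try by congr (_ _); [exact: disj1 cj|exact: disj2 cj].
  + by congr inl; exact: disj1 cj.
  + by case: (D12 w); split; [exact: in1 ci|exact: in2 cj].
  + by case: (D12 w); split; [exact: in1 cj|exact: in2 ci].
  + by congr inr; exact: disj2 cj.
Qed.

End StanleyCones.

Section ProductCones.
Context {r s : nat}.

Definition set_cat (Z : {set 'I_r}) (Y : {set 'I_s}) : {set 'I_(r + s)} :=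
  finset (fun i => match split i with inl j => j \in Z | inr j => j \in Y end).

Lemma card_set_cat Z Y : #|set_cat Z Y| = (#|Z| + #|Y|)%N.
Proof.
rewrite -!sum1_card [in LHS]big_mkcond /= [in LHS]big_split_ord /=.
rewrite [in X in _ = (X + _)%N]big_mkcond [in X in _ = (_ + X)%N]big_mkcond /=.
congr (_ + _)%N; apply: eq_bigr => i _; rewrite inE.
  by rewrite (unsplitK (inl i)).
by rewrite (unsplitK (inr i)).
Qed.

Lemma cone_cat u Z v Y (w : 'X_{1..r + s}) :
  cone (mcat u v) (set_cat Z Y) w = cone u Z (mleft w) && cone v Y (mright w).
Proof.
apply/forallP/andP => [h|[/forallP hl /forallP hr] i].
  split; apply/forallP => i; [have := h (lshift s i)|have := h (rshift r i)];
    rewrite inE !mnmE; by [rewrite (unsplitK (inl i))|rewrite (unsplitK (inr i))].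
rewrite -(splitK i) inE unsplitK; case: split => j /=.
  by have := hl j; rewrite mcatl mnmE.
by have := hr j; rewrite mcatr mnmE.
Qed.

Lemma cone_depth_ge_product (D : set 'X_{1..r}) (E : set 'X_{1..s}) d e :
  cone_depth_ge D d -> cone_depth_ge E e ->
  cone_depth_ge (pre_left D `&` pre_right E) (d + e).
Proof.
move=> [I [u [Z [[memD covD disjD] dZ]]]] [J [v [Y [[memE covE disjE] eY]]]].
exists (I * J)%type, (fun k => mcat (u k.1) (v k.2)), (fun k => set_cat (Z k.1) (Y k.2)).
split=> [|k]; last by rewrite card_set_cat leq_add.
split=> [[i j] w|w [/covD[i ci] /covE[j cj]]|[i j] [i' j'] w] /=; rewrite ?cone_cat.
- by case/andP => /memD ? /memE.
- by exists (i, j); rewrite cone_cat /= ci.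
- by rewrite ?cone_cat => /andP[ci cj] /andP[ci' cj'];
    rewrite (disjD _ _ _ ci ci') (disjE _ _ _ cj cj').
Qed.

(** Freezing the exponents of the second group of variables at [v] and then
    letting all of them vary freely enlarges the sets of free variables. *)
Lemma cone_depth_ge_slice (D : set 'X_{1..r + s}) (v : 'X_{1..s}) d :
  cone_depth_ge D d ->
  cone_depth_ge (pre_left [set u | D (mcat u v)] : set 'X_{1..r + s}) d.
Proof.
move=> [J [u [Z [[inD cov disj] dZ]]]].
pose Zl j : {set 'I_r} := finset (fun i => lshift s i \in Z j).
pose Zr j : {set 'I_s} := finset (fun i => rshift r i \in Z j).
have ZE j : Z j = set_cat (Zl j) (Zr j).
  by apply/setP => i; rewrite inE -{1}(splitK i); case: split => k; rewrite inE.
have cE j w : cone (u j) (Z j) w =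
    cone (mleft (u j)) (Zl j) (mleft w) && cone (mright (u j)) (Zr j) (mright w).
  by rewrite -cone_cat mcatK -ZE.
exists {j | cone (mright (u j)) (Zr j) v},
  (fun j => mcat (mleft (u (val j))) 0), (fun j => set_cat (Zl (val j)) (finset xpredT)).
have cE' j w : cone (mcat (mleft (u j)) 0) (set_cat (Zl j) (finset xpredT)) w =
    cone (mleft (u j)) (Zl j) (mleft w).
  rewrite cone_cat; case: cone => //=; apply/coneP; split=> [|i]; last by rewrite inE.
  by apply/mnm_lepP => i; rewrite mnm0E.
split=> [|[j vj] /=]; last first.
  apply: leq_trans (dZ j) _; rewrite {1}ZE !card_set_cat leq_add2l.
  by apply: subset_leq_card; apply/fintype.subsetP => i _; rewrite inE.
split=> [[j vj] w /=|w Dw|[i vi] [j vj] w /=]; rewrite ?cE'.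
- by move=> cw; apply: (inD j); rewrite cE mleft_mcat mright_mcat cw.
- have [j] := cov _ Dw; rewrite cE mleft_mcat mright_mcat => /andP[cj vj].
  by exists (exist _ j vj); rewrite cE'.
- move=> ci cj; apply: val_inj => /=; apply: (disj _ _ (mcat (mleft w) v)).
    by rewrite cE mleft_mcat mright_mcat ci.
  by rewrite cE mleft_mcat mright_mcat cj.
Qed.

End ProductCones.
(** * Depth as the bound on weakly regular sequences *)

Section KillIdeal.
Context {R : comNzRingType}.
Implicit Types (A B C m : set R) (fs : seq R).

Definition addmuls B fs A : set R := foldl (fun B' f => addmul B' f A) B fs.

Lemma ideal_addmuls B fs A : is_ideal A -> is_ideal B -> is_ideal (addmuls B fs A).
Proof. by move=> iA; elim: fs B => //= f fs ih B iB; apply: ih; exact: ideal_addmul. Qed.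

Lemma addmuls_incl B fs A : is_ideal A -> B `<=` addmuls B fs A.
Proof.
move=> iA; elim: fs B => [B x //|f fs ih B x Bx] /=; apply: ih.
exact: addmul_incl.
Qed.

Lemma addmuls_mul B fs A f a : is_ideal A -> is_ideal B -> f \in fs -> A a ->
  addmuls B fs A (f * a).
Proof.
move=> iA; elim: fs B => // g fs ih B iB; rewrite inE => /orP[/eqP<-|ffs] Aa /=.
  by apply: addmuls_incl => //; exact: addmul_mul.
by apply: ih => //; exact: ideal_addmul.
Qed.

Lemma addmuls_min B fs A C : is_ideal C -> B `<=` C ->
  (forall f a, f \in fs -> A a -> C (f * a)) -> addmuls B fs A `<=` C.
Proof.
move=> iC; elim: fs B => //= f fs ih B BC fC; apply: ih => [|g a gfs].
  by move=> _ [b /BC Cb [_ [a Aa <-] <-]]; apply: ideal_D => //; apply: fC; rewrite ?mem_head.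
by apply: fC; rewrite inE gfs orbT.
Qed.

End KillIdeal.

Section MaximalIdeal.
Context {K : fieldType} {n : nat}.
Local Notation S := {mpoly K[n]}.
Implicit Types (A B C : set S) (P Q : set 'X_{1..n}).

Lemma kill_addmuls A B (fs : seq S) : is_ideal A -> is_ideal B ->
  kill A B fs = addmuls B fs A.
Proof.
move=> iA iB; rewrite eqEsubset; split; last first.
  have iM := ideal_ideal_span [set f * g | f in ideal_span [set f | f \in fs] & g in A].
  apply: addmuls_min => [|b Bb|f a ffs Aa]; first exact: ideal_idealD.
    by exists b => //; exists 0; [exact: ideal_0|rewrite addr0].
  exists 0; first exact: ideal_0.
  exists (f * a); last by rewrite add0r.
  apply: ideal_span_incl; exists f; last by exists a.
  exact: ideal_span_incl.
have iBf := ideal_addmuls fs iA iB.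
move=> _ [b Bb [c Mc <-]]; apply: ideal_D => //; first exact: addmuls_incl.
move: c Mc; apply: ideal_span_min => // _ [g gfs [a Aa <-]].
have icol : is_ideal (colon (addmuls B fs A) a) by exact: ideal_colon.
apply: (ideal_span_min icol _ gfs) => f ffs.
exact: addmuls_mul.
Qed.

Lemma max_ideal_mset : max_ideal = mset [set u | u != 0%MM] :> set S.
Proof.
have up : upset [set u : 'X_{1..n} | u != 0%MM].
  move=> u w /mnm_lepP uw /eqP nu /=; apply/eqP => w0; apply: nu; apply/mnmP => i.
  by have := uw i; rewrite w0 mnm0E leqn0 => /eqP.
rewrite eqEsubset; split.
  apply: ideal_span_min; first exact: (ideal_mset up).
  move=> _ [i _ <-]; apply/msetX => /=; by rewrite mnm1_eq0.
apply: mset_subset => [|u /= u0]; first exact: ideal_ideal_span.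
have [i ui] : exists i, u i != 0%N.
  apply: contrapT => h; move/eqP: u0; apply; apply/mnmP => i; rewrite mnm0E.
  by apply/eqP; apply: contrapT => /negP ?; apply: h; exists i.
rewrite -lep1mP in ui; rewrite -(submK ui) mpolyXD; apply: ideal_M; first exact: ideal_ideal_span.
by apply: ideal_span_incl; exists i.
Qed.

Lemma ideal_max_ideal : is_ideal (max_ideal : set S).
Proof. exact: ideal_ideal_span. Qed.

Lemma max_ideal_proper : ~ (max_ideal : set S) 1.
Proof. by rewrite max_ideal_mset -mpolyX0 msetX /= eqxx. Qed.

Lemma max_idealX i : (max_ideal : set S) 'X_i.
Proof. by apply: ideal_span_incl; exists i. Qed.

Local Notation dge := (@depth_ge _ (max_ideal : set S)).

Lemma regular_sequence_depth_ge A B (fs : seq S) : is_ideal A -> is_ideal B ->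
  (forall f, f \in fs -> max_ideal f) -> regular_sequence A B fs -> dge (size fs) A B.
Proof.
move=> iA iB mfs [reg _]; elim: fs B iB mfs reg => //= f fs ih B iB mfs reg.
exists f; split.
- by apply: mfs; rewrite mem_head.
- by move=> g Ag; have := reg 0%N isT g Ag; rewrite kill_addmuls.
- apply: ih => [|g gfs|i ifs g Ag]; first exact: ideal_addmul.
    by apply: mfs; rewrite inE gfs orbT.
  have := reg i.+1 ifs g Ag; rewrite !kill_addmuls //.
  exact: ideal_addmul.
Qed.

Definition nonzero_mod_max A B : Prop := exists C, [/\ is_ideal C, B `<=` C,
  forall f a, max_ideal f -> A a -> C (f * a) & ~ A `<=` C].

Lemma depth_ge_regular_sequence d A B : is_ideal A -> is_ideal B ->
  nonzero_mod_max A B -> dge d A B ->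
  exists fs : seq S, [/\ size fs = d, forall f, f \in fs -> max_ideal f
    & regular_sequence A B fs].
Proof.
move=> iA iB [C [iC BC mC nAC]] h.
suff [fs [sz mfs reg]] : exists fs : seq S, [/\ size fs = d, forall f, f \in fs -> max_ideal f
    & forall i, (i < size fs)%N -> regular fs`_i A (addmuls B (take i fs) A)].
  exists fs; split=> //; split=> [i ifs|]; first by rewrite kill_addmuls //; exact: reg.
  rewrite kill_addmuls // => h'; apply: nAC; apply: subset_trans h' _.
  by apply: addmuls_min => // f a /mfs mf; exact: mC.
elim: d B iB {BC} h => [|d ih] B iB /=; first by exists [::].
case=> f [mf rf /(ih _ (ideal_addmul f iA iB))[fs [sz mfs reg]]].
exists (f :: fs); split=> [/=|g|[|i]]; first by rewrite sz.
- by rewrite inE => /orP[/eqP->|/mfs].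
- by move=> _; exact: rf.
- exact: reg.
Qed.

Lemma depth_eq d A B : is_ideal A -> is_ideal B -> nonzero_mod_max A B ->
  dge d A B -> ~ dge d.+1 A B -> depth A B = d.
Proof.
move=> iA iB nz dd nd.
set D := [set e | exists fs : seq S, [/\ size fs = e, forall f, f \in fs -> max_ideal f
    & regular_sequence A B fs]].
have Dd : D d by exact: depth_ge_regular_sequence.
have ubD : ubound D d.
  move=> _ [fs [<- mfs reg]]; rewrite leEnat leqNgt; apply/negP => lt_d.
  by apply: nd; apply: depth_ge_leq lt_d _; exact: regular_sequence_depth_ge.
have memD := supremum_nat_mem (ex_intro _ d Dd) (ex_intro _ d ubD).
apply/eqP; rewrite eqn_leq -!leEnat; apply/andP; split; first exact: ubD.
by apply: ge_supremum_Nmem => //; apply: nat_supremums_neq0; exists d.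
Qed.

(** Nakayama's lemma for monomial ideals: an exponent of least degree in
    [P `\` Q] belongs to a minimal generator. *)
Lemma nonzero_mod_max_mset P Q : upset P -> upset Q -> (exists w, (P `\` Q) w) ->
  nonzero_mod_max (mset P) (mset Q).
Proof.
move=> uP uQ [w0 Dw0].
have exd : exists d, `[<exists2 w, (P `\` Q) w & mdeg w = d>].
  by exists (mdeg w0); apply/asboolP; exists w0.
case: (ex_minnP exd) => d /asboolP[w [Pw nQw] <-] wmin.
pose P1 : set 'X_{1..n} := [set v | exists u, [/\ P u, (u <= v)%MM & u != v]].
have uP1 : upset P1.
  move=> v v' vv' [u [Pu uv nuv]]; exists u; split=> //; first exact: lepm_trans vv'.
  apply: contra nuv => /eqP uv'; apply/eqP/mnmP => i; apply/eqP.
  by rewrite eqn_leq (mnm_lepP uv) /= uv' (mnm_lepP vv').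
exists (mset (Q `|` P1)); split.
- exact: ideal_mset (upset_setU uQ uP1).
- by apply: msetS => v; left.
- move=> f a; rewrite max_ideal_mset => mf Pa u /msuppM_le/allpairsP[[v x] [/= vf xa ->]].
  right; exists x; split; [exact: Pa|exact: lem_addl|].
  by have := mf v vf; rewrite -{1}[x]add0m eqm_add2r eq_sym.
- move=> /(_ _ ((msetX P w).2 Pw))/msetX[//|[u [Pu uw nuw]]].
  have nQu : ~ Q u by apply: contra_not nQw; exact: uQ.
  have := wmin (mdeg u) (asboolT (ex_intro2 _ _ u (conj Pu nQu) erefl)).
  rewrite -(submK uw) mdegD -{2}[mdeg u]add0n leq_add2r leqn0 mdeg_eq0 => /eqP wu0.
  by move: nuw; rewrite -(submK uw) wu0 add0m eqxx.
Qed.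

(** * The depth of a polynomial ring and of its monomial ideals *)

Lemma image_mulX (i : 'I_n) : [set 'X_i * a | a in setT] = mset [set u | u i != 0%N] :> set S.
Proof.
rewrite eqEsubset; split=> [_ [a _ <-] u /msuppM_le/allpairsP[[v x] [/= + _ ->]]|].
  by rewrite msuppX inE => /eqP->; rewrite /= mnmDE mnm1E eqxx.
apply: mset_subset => [|u /= ui]; first exact: ideal_image_mul ideal_setT.
by exists 'X_[u - U_(i)] => //; rewrite -mpolyXD addmC submK // lep1mP.
Qed.

Lemma depth_ge_polynomial_ring : dge n setT zero_ideal.
Proof.
pose Q (Y : seq 'I_n) : set 'X_{1..n} := [set u | has (fun i => u i != 0%N) Y].
suff h (l Y : seq 'I_n) : uniq (l ++ Y) -> dge (size l) setT (mset (Q Y)).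
  have := h (enum 'I_n) [::]; rewrite cats0 enum_uniq -cardE card_ord zero_ideal_mset.
  have -> : set0 = Q [::] by rewrite eqEsubset; split=> u.
  exact.
elim: l Y => // i l ih Y /=; rewrite mem_cat negb_or => /andP[/andP[il iY] ul].
exists 'X_i; split; first exact: max_idealX.
  move=> g _ /msetP h; apply/msetP => u nz.
  have /hasP[j jY] : Q Y (U_(i) + u)%MM.
    by apply: h; rewrite mulrC addmC [(u + _)%MM]addmC mcoeffMX.
  rewrite mnmDE mnm1E; have [ij|_] := eqVneq i j; first by rewrite ij jY in iY.
  by move=> uj; apply/hasP; exists j.
have -> : addmul (mset (Q Y)) 'X_i setT = mset (Q (i :: Y)) :> set S.
  rewrite /addmul image_mulX mset_idealD; congr mset.
  by rewrite eqEsubset; split=> u; [case=> h; apply/orP; [right|left]|case/orP; [right|left]].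
apply: ih; move: ul; rewrite !cat_uniq /= negb_or il iY /=.
by case: has => //=.
Qed.

End MaximalIdeal.
(** * No regular sequence of length [n] on a proper quotient *)

Section Words.
Context {R : comNzRingType}.
Implicit Types (fs : seq R).

(** Exponent vectors for a sequence of ring elements, as lists: the induction below
    removes the elements one by one. *)
Fixpoint words (N k : nat) : seq (seq nat) :=
  if k is k'.+1 then [seq j :: b | j <- iota 0 N, b <- words N k'] else [:: [::]].

Fixpoint monom fs (b : seq nat) : R :=
  if fs is f :: fs' then f ^+ head 0%N b * monom fs' (behead b) else 1.

Lemma size_words N k : size (words N k) = (N ^ k)%N.
Proof. by elim: k => //= k ih; rewrite size_allpairs size_iota ih expnS. Qed.

Lemma words_uniq N k : uniq (words N k).
Proof.
elim: k => //= k ih; apply: allpairs_uniq => //; first exact: iota_uniq.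
by move=> [i b] [j c] _ _ /= [-> ->].
Qed.

(** The ideals may be larger than the ones generated by the earlier elements: in the
    application the first is zero and the second is an arbitrary ideal containing the
    first element. *)
Fixpoint regular_chain (B : set R) fs : Prop :=
  if fs is f :: fs' then regular f setT B /\
    exists B', [/\ is_ideal B', B `<=` B', B' f & regular_chain B' fs']
  else ~ B 1.

End Words.

(** Let [j] be the least first exponent with a nonzero coefficient.  Cancel [f ^+ j];
    what remains lies in [B'] up to multiples of [f], and [B'] contains [f]. *)
Lemma regular_chain_independent (K : fieldType) n (B : set {mpoly K[n]}) fs N
    (c : seq nat -> K) : is_ideal B -> regular_chain B fs ->
  B (\sum_(b <- words N (size fs)) c b *: monom fs b) ->
  forall b, b \in words N (size fs) -> c b = 0.
Proof.
elim: fs B c => [|f fs ih] B c iB /=.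
  move=> nB1; rewrite big_seq1 => Bc b; rewrite inE => /eqP->.
  apply/eqP; apply: contrapT => /negP c0; apply: nB1.
  have := ideal_M iB (c [::])^-1%:MP Bc.
  by rewrite mul_mpolyC scalerA mulVf // scale1r.
move=> [rf [B' [iB' BB' B'f chain]]].
rewrite big_allpairs_dep /= => Bsum.
pose E j := \sum_(b <- words N (size fs)) c (j :: b) *: monom fs b.
have sumE j : \sum_(b <- words N (size fs)) c (j :: b) *: (f ^+ j * monom fs b) = f ^+ j * E j.
  by rewrite mulr_sumr; apply: eq_bigr => b _; rewrite scalerAr.
rewrite (eq_bigr _ (fun j _ => sumE j)) in Bsum.
have rfX k g : B (f ^+ k * g) -> B g.
  elim: k => [|k ihk]; first by rewrite mul1r.
  by rewrite exprS -mulrA => /(rf _ I)/ihk.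
suff c0 j : (j < N)%N -> forall b, b \in words N (size fs) -> c (j :: b) = 0.
  by move=> b' /allpairsP[[j b] [/=]]; rewrite mem_iota /= add0n => jN bw ->; exact: c0.
elim/ltn_ind: j => j ihj jN; apply: (ih B') => //.
have Ei i : (i < j)%N -> E i = 0.
  move=> ij; rewrite /E big_seq big1 // => b bw.
  by rewrite (ihj i ij (ltn_trans ij jN) b bw) scale0r.
have splitN : iota 0 N = iota 0 j ++ j :: iota j.+1 (N - j.+1).
  by rewrite -[j :: _]/(iota j (N - j.+1).+1) -iotaD; congr iota; lia.
move: Bsum; rewrite splitN big_cat /= big_seq big1 ?add0r; last first.
  by move=> i; rewrite mem_iota => ij; rewrite Ei ?mulr0.
rewrite big_cons.
pose T := \sum_(i <- iota j.+1 (N - j.+1)) f ^+ (i - j.+1) * E i.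
have -> : \sum_(i <- iota j.+1 (N - j.+1)) f ^+ i * E i = f ^+ j * (f * T).
  rewrite mulrA -exprSr mulr_sumr big_seq [RHS]big_seq; apply: eq_bigr => i.
  by rewrite mem_iota => /andP[ji _]; rewrite mulrA -exprD subnKC.
rewrite -mulrDr => /rfX/BB' h; rewrite -/(E j) -(addrK (f * T) (E j)).
by apply: ideal_B => //; exact: ideal_Mr.
Qed.

Lemma linear_dependence (K : fieldType) n (vs : seq {mpoly K[n]}) (ms : seq 'X_{1..n}) :
  (size ms < size vs)%N ->
  (forall v, v \in vs -> forall u, u \in msupp v -> u \in ms) ->
  exists c : nat -> K, (exists2 i, (i < size vs)%N & c i != 0) /\
    \sum_(i < size vs) c i *: vs`_i = 0.
Proof.
move=> szms vms.
pose A : 'M[K]_(size vs, size ms) := \matrix_(i, j) (vs`_i)@_(nth 0%MM ms j).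
have kerA : kermx A != 0.
  rewrite -mxrank_eq0 mxrank_ker subn_eq0 -ltnNge.
  exact: leq_ltn_trans (rank_leq_col A) szms.
have /rowV0Pn[x /sub_kermxP xA x0] := kerA.
have [i xi] : exists i, x 0 i != 0.
  apply: contrapT => h; move/eqP: x0; apply; apply/rowP => i; rewrite mxE.
  by apply/eqP; apply: contrapT => /negP ?; apply: h; exists i.
pose c k := if insub k is Some i then x 0 i else 0.
have cE (j : 'I_(size vs)) : c j = x 0 j by rewrite /c valK.
exists c; split; first by exists i => //; rewrite cE.
apply/mpolyP => u; rewrite mcoeff0 raddf_sum /=.
have [ums|nums] := boolP (u \in ms); last first.
  rewrite big1 // => j _; rewrite mcoeffZ memN_msupp_eq0 ?mulr0 //.
  by apply: contra nums; apply: vms; exact: mem_nth.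
have /rowP/(_ (Ordinal (etrans (index_mem u ms) ums))) := xA.
rewrite !mxE => e; rewrite -[RHS]e; apply: eq_bigr => j _.
by rewrite mcoeffZ cE !mxE /= nth_index.
Qed.

Lemma mdeg_monom (K : fieldType) n (fs : seq {mpoly K[n]}) D N b :
  (forall f, f \in fs -> forall u, u \in msupp f -> (mdeg u <= D)%N) ->
  b \in words N (size fs) ->
  forall u, u \in msupp (monom fs b) -> (mdeg u <= size fs * N * D)%N.
Proof.
move=> fsD; elim: fs fsD b => [|f fs ih] fsD b /=.
  by move=> _ u; rewrite msupp1 inE => /eqP->; rewrite mdeg0.
case/allpairsP => -[j b'] [/=]; rewrite mem_iota /= add0n => jN b'w -> u.
move=> /msuppM_le/allpairsP[[v w] [/= vf wb ->]]; rewrite mdegD mulSn mulnDl leq_add //.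
  apply: (@leq_trans (j * D)); last by rewrite leq_mul2r ltnW ?orbT.
  elim: j {jN} v vf => [|j ihj] v; first by rewrite expr0 msupp1 inE => /eqP->; rewrite mdeg0.
  rewrite exprS => /msuppM_le/allpairsP[[v1 v2] [/= v1f /ihj v2j ->]].
  rewrite mdegD mulSn leq_add //; apply: fsD v1f; exact: mem_head.
apply: ih wb => // g gfs; apply: fsD; by rewrite inE gfs orbT.
Qed.

(** For large [N], the products of powers of [n + 1] polynomials with exponents below
    [N] outnumber the monomials in [n] variables that can occur in them, so they are
    linearly dependent. *)
Lemma no_long_regular_chain (K : fieldType) n (B : set {mpoly K[n]}) fs :
  is_ideal B -> regular_chain B fs -> size fs = n.+1 -> False.
Proof.
move=> iB chain szfs.
pose D := (\max_(f <- fs) msize f)%N.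
have fsD f : f \in fs -> forall u, u \in msupp f -> (mdeg u <= D)%N.
  move=> ffs u /msize_mdeg_lt/ltnW/leq_trans; apply.
  exact: (leq_bigmax_seq (F := fun f => msize f)).
(* [L ^ n <= (n.+1 * D + 1) ^ n * N ^ n < N ^ n.+1] *)
pose N := ((n.+1 * D + 1) ^ n).+1.
pose L := (n.+1 * N * D).+1.
pose ms := [seq [multinom c i : nat | i < n] | c : {ffun 'I_n -> 'I_L}].
pose ws := words N n.+1.
have szms : (size ms < size (map (monom fs) ws))%N.
  rewrite size_map size_words size_map -cardE card_ffun !card_ord.
  have LN : (L <= (n.+1 * D + 1) * N)%N by rewrite /L /N; nia.
  apply: (@leq_ltn_trans (((n.+1 * D + 1) * N) ^ n)); first last.
    by rewrite expnMn expnS ltn_mul2r expn_gt0 /= /N ltnS leqnn.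
  have [n0|n_gt0] := posnP n; last by rewrite leq_exp2r.
  by rewrite [X in (_ ^ X)%N]n0 [X in (_ <= _ ^ X)%N]n0 !expn0.
have [|c [[i iw ci] c0]] := linear_dependence szms.
  move=> _ /mapP[b bw ->] u ub; have ud : (mdeg u < L)%N.
    by rewrite /L ltnS -szfs; apply: mdeg_monom fsD _ _ ub; rewrite szfs.
  have uL j : (u j < L)%N.
    by apply: leq_ltn_trans ud; rewrite mdegE (bigD1 j) //= leq_addr.
  apply/mapP; exists [ffun j => Ordinal (uL j)]; first by rewrite mem_enum.
  by apply/mnmP => j; rewrite mnmE ffunE.
rewrite size_map in iw c0.
have := regular_chain_independent (N := N) (c := fun b => c (index b ws)) iB chain.
rewrite szfs -/ws.
have -> : \sum_(b <- ws) c (index b ws) *: monom fs b = 0.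
  rewrite -[RHS]c0 (big_nth [::]) big_mkord; apply: eq_bigr => j _.
  by rewrite index_uniq ?words_uniq // (nth_map [::]).
move=> /(_ (ideal_0 iB) (nth [::] ws i) (mem_nth _ iw)).
by rewrite index_uniq ?words_uniq // => /eqP; apply/negP.
Qed.

Section DepthOfQuotient.
Context {K : fieldType} {n : nat}.
Local Notation S := {mpoly K[n]}.
Local Notation dge := (@depth_ge _ (max_ideal : set S)).

(** The chain consists of the ideals [I + (f_1, ..., f_k)], which stay inside the
    maximal ideal. *)
Lemma depth_ge_chain d (I : set S) : is_ideal I -> I `<=` max_ideal -> dge d setT I ->
  exists2 fs : seq S, size fs = d & regular_chain I fs.
Proof.
elim: d I => [|d ih] I iI Im /=.
  by move=> _; exists [::] => // /Im; exact: max_ideal_proper.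
have im := @ideal_max_ideal K n.
case=> f [mf rf df]; have iIf := ideal_addmul f ideal_setT iI.
have [|fs sz chain] := ih _ iIf _ df.
  by move=> _ [b /Im mb [_ [a _ <-] <-]]; apply: ideal_D => //; exact: ideal_Mr.
exists (f :: fs); rewrite /= ?sz //; split=> //.
exists (addmul I f setT); split=> //; first exact: addmul_incl ideal_setT.
by rewrite -{2}[f]mulr1; exact: addmul_mul.
Qed.

Lemma depth_quotient_lt (I : set S) : is_ideal I -> I `<=` max_ideal -> I <> zero_ideal ->
  ~ dge n setT I.
Proof.
move=> iI Im In0 /(depth_ge_chain iI Im)[fs sz chain].
have [g Ig g0] : exists2 g, I g & g != 0.
  apply: contrapT => h; apply: In0; rewrite eqEsubset; split=> [g Ig|_ ->]; last exact: ideal_0.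
  by apply/eqP; apply: contrapT => /negP ?; apply: h; exists g.
apply: (@no_long_regular_chain K n zero_ideal (g :: fs) ideal_zero); rewrite /= ?sz //.
split; last by exists I; split=> // _ ->; exact: ideal_0.
by move=> h _ /eqP; rewrite mulf_eq0 (negbTE g0) => /eqP.
Qed.

(** Both inequalities come from [0 -> I -> S -> S / I -> 0], where [S] has depth [n]
    and [S / I] has smaller depth. *)
Lemma depth_ideal d (I : set S) : is_ideal I -> I `<=` max_ideal -> I <> zero_ideal ->
  dge d setT I <-> dge d.+1 I zero_ideal.
Proof.
move=> iI Im In0; have iT := @ideal_setT S; have i0 := @ideal_zero S.
have noeth := @mpoly_noetherian K n; have im := @ideal_max_ideal K n.
have zI : zero_ideal `<=` I by move=> _ ->; exact: ideal_0.
have dS e : (e <= n)%N -> dge e setT zero_ideal.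
  by move=> en; apply: depth_ge_leq en _; exact: depth_ge_polynomial_ring.
have dI e : dge e setT I -> (e < n)%N.
  by move=> de; rewrite ltnNge; apply/negP => ne;
    apply: (depth_quotient_lt iI Im In0); exact: depth_ge_leq de.
split=> h; first by apply: (depth_ge_sub noeth im iT iI i0) => //; exact/dS/dI.
have [dn|nd] := leqP d n; first by apply: (depth_ge_quo noeth im iT iI i0 zI _ h) => //; exact: dS.
have h' := depth_ge_leq nd (depth_geS h).
suff : dge n setT I by move/dI; rewrite ltnn.
by apply: (depth_ge_quo noeth im iT iI i0 zI _ h') => //; exact: dS.
Qed.

End DepthOfQuotient.
(** * Tensor products of subquotients *)

Section TensorProduct.
Context {K : fieldType} {S1 S2 S : comAlgType K}.
Variables (i1 : {rmorphism S1 -> S}) (i2 : {rmorphism S2 -> S}).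
Implicit Types (V : set S1) (W : set S2) (l : seq (S1 * S2)).

Definition psum l : S := \sum_(p <- l) i1 p.1 * i2 p.2.

(** When [S] is the tensor product of [S1] and [S2], this is the image of the
    tensor product of [V] and [W]. *)
Definition tens V W : set S :=
  [set x | exists l, (forall p, p \in l -> V p.1 /\ W p.2) /\ x = psum l].

(** The kernel of the map onto the tensor product of [V0 / V1] and [W0 / W1]. *)
Definition tens_ker V0 V1 W0 W1 : set S := idealD (tens V1 W0) (tens V0 W1).

Lemma psum_cons p l : psum (p :: l) = i1 p.1 * i2 p.2 + psum l.
Proof. exact: big_cons. Qed.

Lemma tens_mul V W a b : V a -> W b -> tens V W (i1 a * i2 b).
Proof.
move=> Va Wb; exists [:: (a, b)]; split=> [p|]; first by rewrite inE => /eqP->.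
by rewrite /psum big_seq1.
Qed.

Lemma tens_min V W C : is_ideal C -> (forall a b, V a -> W b -> C (i1 a * i2 b)) ->
  tens V W `<=` C.
Proof.
move=> iC h _ [l [lVW ->]]; rewrite /psum big_seq; apply: ideal_sum => // p /lVW[].
exact: h.
Qed.

(* [i1] and [i2] agree on scalars. *)
Hypothesis scale_move : forall c a b, i1 (c *: a) * i2 b = i1 a * i2 (c *: b).
Hypothesis i12_gen : forall x, tens setT setT x.

Lemma ideal_tens V W : is_ideal V -> is_ideal W -> is_ideal (tens V W).
Proof.
move=> iV iW; have tD x y : tens V W x -> tens V W y -> tens V W (x + y).
  move=> [l [lVW ->]] [l' [lVW' ->]]; exists (l ++ l'); split; last by rewrite /psum big_cat.
  by move=> p; rewrite mem_cat => /orP[/lVW|/lVW'].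
have t0 : tens V W 0 by exists [::]; rewrite /psum big_nil.
split=> // x _ [l [lVW ->]]; have [k [_ ->]] := i12_gen x.
rewrite mulr_suml; apply: (big_ind (tens V W)) => // q _.
rewrite mulr_sumr big_seq; apply: (big_ind (tens V W)) => // p /lVW[Vp Wp].
rewrite mulrACA -!rmorphM; apply: tens_mul; exact: ideal_M.
Qed.

Lemma ideal_tens_ker V0 V1 W0 W1 : is_ideal V0 -> is_ideal V1 -> is_ideal W0 -> is_ideal W1 ->
  is_ideal (tens_ker V0 V1 W0 W1).
Proof. by move=> *; apply: ideal_idealD; exact: ideal_tens. Qed.

Lemma tens_kerl V0 V1 W0 W1 a b : is_ideal V0 -> is_ideal W1 -> V1 a -> W0 b ->
  tens_ker V0 V1 W0 W1 (i1 a * i2 b).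
Proof.
move=> iV0 iW1 Va Wb; exists (i1 a * i2 b); first exact: tens_mul.
by exists 0; [exact: ideal_0 (ideal_tens iV0 iW1)|rewrite addr0].
Qed.

Lemma tens_kerr V0 V1 W0 W1 a b : is_ideal V1 -> is_ideal W0 -> V0 a -> W1 b ->
  tens_ker V0 V1 W0 W1 (i1 a * i2 b).
Proof.
move=> iV1 iW0 Va Wb; exists 0; first exact: ideal_0 (ideal_tens iV1 iW0).
by exists (i1 a * i2 b); [exact: tens_mul|rewrite add0r].
Qed.

Lemma tens_ker_addmul V0 V1 W0 W1 f :
  is_ideal V0 -> is_ideal V1 -> is_ideal W0 -> is_ideal W1 ->
  tens_ker V0 (addmul V1 f V0) W0 W1 =
  addmul (tens_ker V0 V1 W0 W1) (i1 f) (tens V0 W0).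
Proof.
move=> iV0 iV1 iW0 iW1; have iVf := ideal_addmul f iV0 iV1.
have iZ := ideal_tens_ker iV0 iV1 iW0 iW1.
have iZf := ideal_tens_ker iV0 iVf iW0 iW1.
have iT := ideal_tens iV0 iW0.
have iA := ideal_addmul (i1 f) iT iZ.
rewrite eqEsubset; split=> x.
  case=> y yT [z zT <-]; apply: ideal_D => //.
    move: y yT; apply: tens_min => // _ b [a Va [_ [c Vc <-] <-]] Wb.
    rewrite rmorphD rmorphM mulrDl -mulrA; apply: ideal_D => //.
      by apply: addmul_incl => //; exact: tens_kerl.
    by apply: addmul_mul => //; exact: tens_mul.
  move: z zT; apply: tens_min => // a b Va Wb.
  by apply: addmul_incl => //; exact: tens_kerr.
case/addmulP=> y [yT xZ]; rewrite -(subrK (i1 f * y) x); apply: ideal_D => //.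
  case: xZ => u uT [v vT <-]; apply: ideal_D => //.
    move: u uT; apply: tens_min => // a b Va Wb; apply: tens_kerl => //.
    exact: addmul_incl.
  by move: v vT; apply: tens_min => // a b Va Wb; exact: tens_kerr.
rewrite mulrC; clear xZ; move: y yT.
have icol : is_ideal (colon (tens_ker V0 (addmul V1 f V0) W0 W1) (i1 f)).
  exact: ideal_colon.
apply: tens_min => // a b Va Wb; rewrite /colon /= mulrC mulrA -rmorphM.
by apply: tens_kerl => //; exact: addmul_mul.
Qed.

(** A linear form on [S1] together with its extension of scalars. *)
Definition slice (phi : S1 -> K) (Phi : S -> S2) : Prop :=
  [/\ forall c x y, phi (c *: x + y) = c * phi x + phi y,
      forall x y, Phi (x + y) = Phi x + Phi y
    & forall a b, Phi (i1 a * i2 b) = phi a *: b].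

Hypothesis slices_separate : forall v, v != 0 -> exists phi Phi, slice phi Phi /\ phi v != 0.

Lemma slice_comb phi Phi psi Psi c : slice phi Phi -> slice psi Psi ->
  slice (fun x => psi x - c * phi x) (fun x => Psi x - c *: Phi x).
Proof.
move=> [l1 a1 e1] [l2 a2 e2]; split=> [d x y|x y|a b].
- by rewrite l1 l2; ring.
- by rewrite a1 a2 scalerDr opprD addrACA.
- by rewrite e1 e2 scalerA scalerBl.
Qed.

Lemma slice_scale phi Phi c : slice phi Phi -> slice (fun x => c * phi x) (fun x => c *: Phi x).
Proof.
move=> [l1 a1 e1]; split=> [d x y|x y|a b].
- by rewrite l1 mulrDr mulrCA.
- by rewrite a1 scalerDr.
- by rewrite e1 scalerA.
Qed.

Lemma sliceB phi Phi c x y : slice phi Phi -> phi (x - c *: y) = phi x - c * phi y.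
Proof. by move=> [l _ _]; rewrite addrC -scaleNr l mulNr addrC. Qed.

Fixpoint lspan (L : seq S1) : set S1 :=
  if L is a :: L' then [set x | exists c : K, lspan L' (x - c *: a)] else [set 0].

Lemma lspan_ideal V L : is_ideal V -> (forall a, a \in L -> V a) -> lspan L `<=` V.
Proof.
move=> iV; elim: L => [|a L ih] LV x /=; first by move->; exact: ideal_0.
case=> c /ih xV; rewrite -(subrK (c *: a) x); apply: ideal_D => //.
  by apply: xV => b bL; apply: LV; rewrite inE bL orbT.
by rewrite -[a]mul1r scalerAl; apply: ideal_M => //; apply: LV; exact: mem_head.
Qed.

Lemma slice_lspan phi Phi L x : slice phi Phi -> (forall a, a \in L -> phi a = 0) ->
  lspan L x -> phi x = 0.
Proof.
move=> sl; elim: L x => [|a L ih] x pL /=.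
  by move->; have [l _ _] := sl; have := l (-1) 0 0; rewrite scaler0 addr0 mulN1r addNr.
move=> [c /ih]; rewrite (sliceB _ _ _ sl) (pL a) ?mem_head // mulr0 subr0; apply.
by move=> b bL; apply: pL; rewrite inE bL orbT.
Qed.

(** Induction on [L]: if [a] is not yet in the span, subtract from a form that
    separates [v] the right multiple of a form that separates [a]. *)
Lemma separating_slice (L : seq S1) v : ~ lspan L v ->
  exists phi Phi, [/\ slice phi Phi, phi v = 1 & forall a, a \in L -> phi a = 0].
Proof.
elim: L v => [|a L ih] v /= nv.
  have [phi [Phi [sl nz]]] := slices_separate (introN eqP nv).
  exists (fun x => (phi v)^-1 * phi x), (fun x => (phi v)^-1 *: Phi x).
  by split=> //; [exact: slice_scale|rewrite mulVf].
have [aL|naL] := pselect (lspan L a).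
  have [|phi [Phi [sl pv pL]]] := ih v.
    by move=> vL; apply: nv; exists 0; rewrite scale0r subr0.
  exists phi, Phi; split=> // b; rewrite inE => /orP[/eqP->|/pL//].
  exact: slice_lspan sl pL aL.
have [phi [Phi [sl pa pL]]] := ih a naL.
have [|psi [Psi [sl' pv pL']]] := ih (v - phi v *: a).
  by move=> vL; apply: nv; exists (phi v).
exists (fun x => psi x - psi a * phi x), (fun x => Psi x - psi a *: Phi x); split.
- exact: slice_comb.
- by rewrite -pv (sliceB _ _ _ sl') [phi v * _]mulrC.
- move=> b; rewrite inE => /orP[/eqP->|bL]; first by rewrite pa mulr1 subrr.
  by rewrite pL // pL' // mulr0 subr0.
Qed.

Lemma slice_psum phi Phi g l : slice phi Phi ->
  Phi (i2 g * psum l) = g * \sum_(p <- l) phi p.1 *: p.2.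
Proof.
move=> [_ add e]; have Phi0 : Phi 0 = 0 by apply: (addrI (Phi 0)); rewrite -add !addr0.
elim: l => [|p l ih]; first by rewrite /psum !big_nil !mulr0.
rewrite psum_cons big_cons !mulrDr add ih; congr (_ + _).
by rewrite mulrCA -rmorphM e scalerAr.
Qed.

(** A first component that depends linearly on the others can be removed from a
    tensor by changing the second components. *)
Lemma psum_absorb V W l (L : seq S1) v w : is_ideal W -> W w ->
  (forall p, p \in l -> V p.1 /\ W p.2) ->
  lspan (map fst l ++ L) v -> exists y l', [/\ lspan L y, size l' = size l,
    forall p, p \in l' -> V p.1 /\ W p.2 & psum l + i1 v * i2 w = psum l' + i1 y * i2 w].
Proof.
move=> iW Ww; elim: l v => [|p l ih] v /= lVW; first by exists v, [::].
case=> c /ih[|y [l' [Ly sz lVW' e]]]; first by move=> q ql; apply: lVW; rewrite inE ql orbT.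
have [Vp Wp] := lVW p (mem_head _ _).
exists y, ((p.1, p.2 + c *: w) :: l'); split=> //=; first by rewrite sz.
- move=> q; rewrite inE => /orP[/eqP->|/lVW'//]; split=> //=; apply: ideal_D => //.
  by rewrite -[w]mul1r scalerAl; exact: ideal_M.
- have ev : i1 v * i2 w = i1 (v - c *: p.1) * i2 w + i1 p.1 * i2 (c *: w).
    by rewrite -scale_move -mulrDl -rmorphD subrK.
  rewrite !psum_cons /= rmorphD mulrDr ev -[RHS]addrA -e; ring.
Qed.

(** Flatness over a field.  In a tensor killed by [g] the first components may be
    taken linearly independent modulo those of the relation, and a slice then
    isolates one second component. *)
Lemma tens_regular V0 V1 W0 W1 g : is_ideal V0 -> is_ideal V1 -> is_ideal W0 -> is_ideal W1 ->
  regular g W0 W1 -> regular (i2 g) (tens V0 W0) (tens_ker V0 V1 W0 W1).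
Proof.
move=> iV0 iV1 iW0 iW1 rg _ [l [lVW ->]].
have iZ := ideal_tens_ker iV0 iV1 iW0 iW1.
elim: {l}(size l) {-2}l (erefl (size l)) lVW => [|k ih] [|p l] //= sz lVW.
  by move=> _; rewrite /psum big_nil; exact: ideal_0.
case: sz => sz Zgl.
have lVW' q : q \in l -> V0 q.1 /\ W0 q.2 by move=> ql; apply: lVW; rewrite inE ql orbT.
have [Vp Wp] := lVW p (mem_head _ _).
have [_ [m1 [m1P ->]] [_ [m2 [m2P ->]] Zeq]] := Zgl.
have m1V a : a \in map fst m1 -> V1 a by case/mapP=> q /m1P[? _] ->.
have [inL|ninL] := pselect (lspan (map fst l ++ map fst m1) p.1).
  have [y [l' [yL sz' lP' e]]] := psum_absorb iW0 Wp lVW' inL.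
  have Zy : tens_ker V0 V1 W0 W1 (i1 y * i2 p.2).
    by apply: tens_kerl => //; exact: lspan_ideal yL.
  have pE : psum (p :: l) = psum l' + i1 y * i2 p.2 by rewrite psum_cons addrC e.
  rewrite pE; apply: ideal_D => //; apply: ih => //; first by rewrite sz'.
  have -> : psum l' = psum (p :: l) - i1 y * i2 p.2 by rewrite pE addrK.
  by rewrite mulrBr; apply: ideal_B => //; exact: ideal_M.
have [phi [Phi [sl pv pL]]] := separating_slice ninL.
have pl a : a \in map fst l -> phi a = 0 by move=> ?; apply: pL; rewrite mem_cat; apply/orP; left.
have pm a : a \in map fst m1 -> phi a = 0 by move=> ?; apply: pL; rewrite mem_cat; apply/orP; right.
have sum0 l0 : (forall a, a \in map fst l0 -> phi a = 0) -> \sum_(q <- l0) phi q.1 *: q.2 = 0.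
  by move=> h; rewrite big_seq big1 // => q ql; rewrite h ?scale0r // map_f.
have Wp1 : W1 p.2.
  apply: rg => //; have := congr1 Phi Zeq.
  rewrite (slice_psum _ _ sl) big_cons (sum0 l) // pv scale1r addr0 => <-.
  have [_ add _] := sl; rewrite add -[psum m1]mul1r -[psum m2]mul1r -(rmorph1 i2).
  rewrite !(slice_psum _ _ sl) (sum0 m1) // mulr0 add0r mul1r big_seq.
  apply: ideal_sum => // q /m2P[_ Wq].
  by rewrite -[q.2]mul1r scalerAl; exact: ideal_M.
have Zp : tens_ker V0 V1 W0 W1 (i1 p.1 * i2 p.2) by exact: tens_kerr.
rewrite psum_cons; apply: ideal_D => //; apply: ih => //.
have -> : psum l = psum (p :: l) - i1 p.1 * i2 p.2 by rewrite psum_cons addrAC subrr add0r.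
by rewrite mulrBr; apply: ideal_B => //; exact: ideal_M.
Qed.

Lemma tens_socle V0 V1 W0 W1 a b : is_ideal V0 -> is_ideal V1 -> is_ideal W0 -> is_ideal W1 ->
  ~ V1 a -> tens_ker V0 V1 W0 W1 (i1 a * i2 b) -> W1 b.
Proof.
move=> iV0 iV1 iW0 iW1 nVa [_ [m1 [m1P ->]] [_ [m2 [m2P ->]] Zeq]].
have m1V x : x \in map fst m1 -> V1 x by case/mapP=> q /m1P[? _] ->.
have [|phi [Phi [sl pa pL]]] := @separating_slice (map fst m1) a.
  by move=> /(lspan_ideal iV1 m1V).
have [_ add e] := sl; have := congr1 Phi Zeq.
rewrite add e pa scale1r -[psum m1]mul1r -[psum m2]mul1r -(rmorph1 i2).
rewrite !(slice_psum _ _ sl) big_seq big1 => [|q qm]; last by rewrite pL ?scale0r // map_f.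
rewrite mulr0 add0r mul1r big_seq => <-.
apply: ideal_sum => // q /m2P[_ Wq].
by rewrite -[q.2]mul1r scalerAl; exact: ideal_M.
Qed.

End TensorProduct.
(** * Depth of tensor products over two groups of variables *)

Section TensorSwap.
Context {K : fieldType} {S1 S2 S : comAlgType K}.
Variables (i1 : {rmorphism S1 -> S}) (i2 : {rmorphism S2 -> S}).

Lemma tensC V W : tens i2 i1 W V = tens i1 i2 V W.
Proof.
by rewrite eqEsubset; split=> x [l [lVW ->]]; exists [seq (p.2, p.1) | p <- l]; split;
  rewrite /psum ?big_map; [move=> _ /mapP[p /lVW[? ?] ->]| |move=> _ /mapP[p /lVW[? ?] ->]|] => //;
  apply: eq_bigr => p _; rewrite mulrC.
Qed.

Lemma tens_kerC V0 V1 W0 W1 : tens_ker i2 i1 W0 W1 V0 V1 = tens_ker i1 i2 V0 V1 W0 W1.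
Proof.
rewrite /tens_ker !tensC eqEsubset; split=> x [y yT [z zT <-]];
  by exists z => //; exists y => //; rewrite addrC.
Qed.

End TensorSwap.

Section TwoGroupsDepth.
Context {K : fieldType} {r s : nat}.
Local Notation S1 := {mpoly K[r]}.
Local Notation S2 := {mpoly K[s]}.
Local Notation S := {mpoly K[r + s]}.
Implicit Types (V : set S1) (W : set S2) (P : set 'X_{1..r}) (Q : set 'X_{1..s}).

Definition emb k n (h : 'I_k -> 'I_n) : {rmorphism {mpoly K[k]} -> {mpoly K[n]}} :=
  comp_mpoly [tuple 'X_(h i) | i < k].

Local Notation i1 := (emb (@lshift r s)).
Local Notation i2 := (emb (@rshift r s)).

Lemma embE k n (h : 'I_k -> 'I_n) p : emb h p = rename_vars h p.
Proof. by []. Qed.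

Lemma embZ k n (h : 'I_k -> 'I_n) c p : emb h (c *: p) = c *: emb h p.
Proof. exact: comp_mpolyZ. Qed.

Lemma emb_scale_move c (a : S1) (b : S2) : i1 (c *: a) * i2 b = i1 a * i2 (c *: b).
Proof. by rewrite !embZ -scalerAl -scalerAr. Qed.

Lemma embX u v : i1 'X_[u] * i2 'X_[v] = 'X_[mcat u v] :> S.
Proof. by rewrite !embE rename_lshiftX rename_rshiftX -mpolyXD -mcat_split. Qed.

Lemma emb_gen (x : S) : tens i1 i2 setT setT x.
Proof.
exists [seq (x@_w *: 'X_[mleft w], 'X_[mright w]) | w <- msupp x]; split=> //.
rewrite /psum big_map {1}(mpolyE x); apply: eq_bigr => w _.
by rewrite embZ -scalerAl embX mcatK.
Qed.

Lemma mcoeff_emb (a : S1) (b : S2) u v : (i1 a * i2 b)@_(mcat u v) = a@_u * b@_v.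
Proof.
rewrite !embE rename_varsE (rename_varsE _ b) mulr_suml raddf_sum /=.
have cE k (p : {mpoly K[k]}) w : p@_w = \sum_(w' <- msupp p) p@_w' * (w' == w)%:R.
  rewrite {1}(mpolyE p) raddf_sum; apply: eq_bigr => w' _ /=.
  by rewrite mcoeffZ mcoeffX.
rewrite (cE _ a) (cE _ b) mulr_suml; apply: eq_bigr => u' _.
rewrite !mulr_sumr raddf_sum; apply: eq_bigr => v' _ /=.
rewrite -scalerAl -scalerAr -!embE embX !mcoeffZ !mcoeffX.
have -> : (mcat u' v' == mcat u v) = (u' == u) && (v' == v).
  apply/eqP/andP => [e|[/eqP-> /eqP->]//].
  by rewrite -{1}(mleft_mcat u' v') -{2}(mright_mcat u' v') e mleft_mcat mright_mcat !eqxx.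
by do 2!case: eqP => _; rewrite ?mulr0 ?mul0r ?mulr1.
Qed.

(** The coefficient of [p] at the exponent [m v] becomes the one at [v].  The bound on
    the degree of [v] makes the sum finite; it loses nothing when [m] does not
    lower degrees. *)
Definition mslice k n (m : 'X_{1..k} -> 'X_{1..n}) (p : {mpoly K[n]}) : {mpoly K[k]} :=
  \sum_(v : 'X_{1..k < msize p}) p@_(m v) *: 'X_[v].

Lemma mcoeff_mslice k n (m : 'X_{1..k} -> 'X_{1..n}) p v :
  (forall v, mdeg v <= mdeg (m v))%N -> (mslice m p)@_v = p@_(m v).
Proof.
move=> dm; have [lt|ge] := ltnP (mdeg v) (msize p).
  exact: (mcoeff_mpoly (fun v => p@_(m v)) lt).
rewrite (memN_msupp_eq0 (m := m v)); last first.
  by apply: msize_mdeg_ge; exact: leq_trans ge (dm v).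
rewrite /mslice raddf_sum big1 //= => w _; rewrite mcoeffZ mcoeffX.
case: eqP => [e|_]; last by rewrite mulr0.
by have := bmdeg w; rewrite e ltnNge ge.
Qed.

Lemma mdeg_mcat (u : 'X_{1..r}) (v : 'X_{1..s}) : mdeg (mcat u v) = (mdeg u + mdeg v)%N.
Proof.
rewrite !mdegE big_split_ord /=; congr (_ + _)%N; apply: eq_bigr => i _.
  by rewrite mcatl.
by rewrite mcatr.
Qed.

Lemma slices_left (a : S1) : a != 0 ->
  exists phi Phi, slice i1 i2 phi Phi /\ phi a != 0.
Proof.
rewrite -msupp_eq0; case E : (msupp a) => [//|u l] _.
have ua : a@_u != 0 by rewrite -mcoeff_msupp E mem_head.
exists (mcoeff u), (mslice (mcat u)); split=> //.
have cE p (v : 'X_{1..s}) : (mslice (mcat u) p)@_v = p@_(mcat u v).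
  by rewrite mcoeff_mslice // => w; rewrite mdeg_mcat leq_addl.
split=> [c x y|x y|x y]; first by rewrite mcoeffD mcoeffZ.
  by apply/mpolyP => v; rewrite mcoeffD !cE mcoeffD.
by apply/mpolyP => v; rewrite cE mcoeff_emb mcoeffZ.
Qed.

Lemma slices_right (b : S2) : b != 0 ->
  exists phi Phi, slice i2 i1 phi Phi /\ phi b != 0.
Proof.
rewrite -msupp_eq0; case E : (msupp b) => [//|v l] _.
have vb : b@_v != 0 by rewrite -mcoeff_msupp E mem_head.
exists (mcoeff v), (mslice (mcat^~ v)); split=> //.
have cE p (u : 'X_{1..r}) : (mslice (mcat^~ v) p)@_u = p@_(mcat u v).
  by rewrite mcoeff_mslice // => w; rewrite mdeg_mcat leq_addr.
split=> [c x y|x y|x y]; first by rewrite mcoeffD mcoeffZ.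
  by apply/mpolyP => u; rewrite mcoeffD !cE mcoeffD.
by apply/mpolyP => u; rewrite cE mulrC mcoeff_emb mcoeffZ mulrC.
Qed.

Lemma emb_gen_swap (x : S) : tens i2 i1 setT setT x.
Proof. by rewrite tensC; exact: emb_gen. Qed.

Lemma emb_scale_move_swap c (b : S2) (a : S1) : i2 (c *: b) * i1 a = i2 b * i1 (c *: a).
Proof. by rewrite ![i2 _ * _]mulrC emb_scale_move. Qed.

Local Notation T := (tens i1 i2).
Local Notation Z := (tens_ker i1 i2).
Local Notation dge1 := (@depth_ge _ (max_ideal : set S1)).
Local Notation dge2 := (@depth_ge _ (max_ideal : set S2)).
Local Notation dge := (@depth_ge _ (max_ideal : set S)).

Section Ideals.
Variables (V0 : set S1) (W0 : set S2).
Hypotheses (iV0 : is_ideal V0) (iW0 : is_ideal W0).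

Lemma tens_regular_left V1 W1 f : is_ideal V1 -> is_ideal W1 ->
  regular f V0 V1 -> regular (i1 f) (T V0 W0) (Z V0 V1 W0 W1).
Proof.
move=> iV1 iW1 rf; rewrite -tensC -tens_kerC.
exact: (tens_regular emb_scale_move_swap emb_gen_swap slices_right).
Qed.

Lemma tens_regular_right V1 W1 g : is_ideal V1 -> is_ideal W1 ->
  regular g W0 W1 -> regular (i2 g) (T V0 W0) (Z V0 V1 W0 W1).
Proof.
move=> iV1 iW1 rg.
exact: (tens_regular emb_scale_move emb_gen slices_left).
Qed.

Lemma tens_ker_addmul_right V1 W1 g : is_ideal V1 -> is_ideal W1 ->
  Z V0 V1 W0 (addmul W1 g W0) = addmul (Z V0 V1 W0 W1) (i2 g) (T V0 W0).
Proof.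
move=> iV1 iW1.
rewrite -(tens_kerC i1 i2 V0 V1 W0 W1) -(tens_kerC i1 i2 V0 V1 W0 (addmul W1 g W0)).
rewrite -(tensC i1 i2 V0 W0).
exact: (tens_ker_addmul emb_gen_swap).
Qed.

Lemma emb_max_ideal k n (h : 'I_k -> 'I_n) f : max_ideal f -> max_ideal (emb h f).
Proof.
have icol : is_ideal [set f | (max_ideal : set {mpoly K[n]}) (emb h f)].
  have im := @ideal_max_ideal K n; split=> [|x y mx my|x y my] /=.
  - by rewrite rmorph0; exact: ideal_0.
  - by rewrite rmorphD; exact: ideal_D.
  - by rewrite rmorphM; exact: ideal_M.
apply: (ideal_span_min icol) => _ [i _ <-] /=.
by rewrite comp_mpolyXU -tnth_nth tnth_mktuple; exact: max_idealX.
Qed.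

Lemma depth_ge_tens a b V1 W1 : is_ideal V1 -> is_ideal W1 ->
  dge1 a V0 V1 -> dge2 b W0 W1 -> dge (a + b) (T V0 W0) (Z V0 V1 W0 W1).
Proof.
elim: a V1 => [|a ih] V1 iV1 iW1.
  move=> _; elim: b W1 iW1 => // b ihb W1 iW1 [g [mg rg dg]].
  exists (i2 g); split; [exact: emb_max_ideal|exact: tens_regular_right|].
  by rewrite -tens_ker_addmul_right //; apply: ihb => //; exact: ideal_addmul.
move=> [f [mf rf df]] db; exists (i1 f); split; [exact: emb_max_ideal|exact: tens_regular_left|].
by rewrite -(tens_ker_addmul emb_gen) //; apply: ih => //; exact: ideal_addmul.
Qed.

Lemma socle_tens V1 W1 : is_ideal V1 -> is_ideal W1 ->
  ~ socle_free max_ideal V0 V1 -> ~ socle_free max_ideal W0 W1 ->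
  ~ socle_free max_ideal (T V0 W0) (Z V0 V1 W0 W1).
Proof.
move=> iV1 iW1 nV nW sf.
have [a [Va ma nVa]] : exists a, [/\ V0 a, forall f, max_ideal f -> V1 (f * a) & ~ V1 a].
  by apply: contrapT => h; apply: nV => a Va ma; apply: contrapT => ?; apply: h; exists a.
apply: nW => b Wb mb; apply: (tens_socle slices_left iV0 iV1 iW0 iW1 nVa).
apply: sf; first exact: tens_mul.
have iZ := ideal_tens_ker emb_gen iV0 iV1 iW0 iW1.
have icol : is_ideal (colon (Z V0 V1 W0 W1) (i1 a * i2 b)) by exact: ideal_colon.
apply: (ideal_span_min icol) => _ [i _ <-]; rewrite /colon /= -(splitK i).
case: split => j /=.
  have -> : 'X_(lshift s j) = i1 'X_j by rewrite /= comp_mpolyXU -tnth_nth tnth_mktuple.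
  rewrite mulrA -rmorphM; apply: (tens_kerl emb_gen) => //; exact/ma/max_idealX.
have -> : 'X_(rshift r j) = i2 'X_j by rewrite /= comp_mpolyXU -tnth_nth tnth_mktuple.
rewrite mulrCA -rmorphM; apply: (tens_kerr emb_gen) => //; exact/mb/max_idealX.
Qed.

(** Divide by regular sequences of both factors until both have a socle. *)
Lemma not_depth_ge_tens a b V1 W1 : is_ideal V1 -> is_ideal W1 ->
  dge1 a V0 V1 -> ~ dge1 a.+1 V0 V1 -> dge2 b W0 W1 -> ~ dge2 b.+1 W0 W1 ->
  ~ dge (a + b).+1 (T V0 W0) (Z V0 V1 W0 W1).
Proof.
have noeth := @mpoly_noetherian K (r + s); have im := @ideal_max_ideal K (r + s).
have iT := ideal_tens emb_gen iV0 iW0.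
elim: a V1 => [|a ih] V1 iV1 iW1.
  move=> _ nV; elim: b W1 iW1 => [|b ihb] W1 iW1.
    move=> _ nW /depth_ge_socle; apply: socle_tens => //.
      by move=> sf; apply: nV; apply: socle_depth_ge sf => //;
        [exact: mpoly_noetherian|exact: ideal_max_ideal].
    by move=> sf; apply: nW; apply: socle_depth_ge sf => //;
      [exact: mpoly_noetherian|exact: ideal_max_ideal].
  move=> [g [mg rg dg]] nW dT; have iWg := ideal_addmul g iW0 iW1.
  apply: (ihb _ iWg dg); first by move=> dg'; apply: nW; exists g.
  rewrite tens_ker_addmul_right //.
  apply: (depth_ge_quotient noeth im iT _ _ dT); [exact: ideal_tens_ker emb_gen _ _ _ _ _ _ _ _| |].
    exact: emb_max_ideal.
  exact: tens_regular_right.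
move=> [f [mf rf df]] nV db nW dT; have iVf := ideal_addmul f iV0 iV1.
apply: (ih _ iVf iW1 df _ db nW); first by move=> df'; apply: nV; exists f.
rewrite (tens_ker_addmul emb_gen) //.
apply: (depth_ge_quotient noeth im iT _ _ dT); [exact: ideal_tens_ker emb_gen _ _ _ _ _ _ _ _| |].
  exact: emb_max_ideal.
exact: tens_regular_left.
Qed.

End Ideals.

Lemma tens_mset P Q : upset P -> upset Q ->
  T (mset P) (mset Q) = mset (pre_left P `&` pre_right Q).
Proof.
move=> uP uQ; rewrite eqEsubset; split.
  have uL := upset_pre_left (s := s) uP; have uR := upset_pre_right (r := r) uQ.
  rewrite -mset_setI -extl_mset // -extr_mset //.
  apply: tens_min => [|a b Pa Qb]; first by apply: ideal_setI; exact: ideal_ideal_span.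
  split.
    by apply: ideal_Mr; [exact: ideal_ideal_span|apply: ideal_span_incl; exists a].
  by apply: ideal_M; [exact: ideal_ideal_span|apply: ideal_span_incl; exists b].
apply: mset_subset => [|w [Pw Qw]].
  by apply: (ideal_tens emb_gen); exact: ideal_mset.
by rewrite -(mcatK w) -embX; apply: tens_mul; exact/msetX.
Qed.

Lemma depth_tens_mset P0 P1 Q0 Q1 a b : upset P0 -> upset P1 -> upset Q0 -> upset Q1 ->
  dge1 a (mset P0) (mset P1) -> ~ dge1 a.+1 (mset P0) (mset P1) ->
  dge2 b (mset Q0) (mset Q1) -> ~ dge2 b.+1 (mset Q0) (mset Q1) ->
  let A := mset (pre_left P0 `&` pre_right Q0) in
  let B := mset ((pre_left P1 `&` pre_right Q0) `|` (pre_left P0 `&` pre_right Q1)) in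
  dge (a + b) A B /\ ~ dge (a + b).+1 A B.
Proof.
move=> uP0 uP1 uQ0 uQ1 da na db nb A B.
have -> : A = T (mset P0) (mset Q0) by rewrite tens_mset.
have -> : B = Z (mset P0) (mset P1) (mset Q0) (mset Q1).
  by rewrite /tens_ker !tens_mset // mset_idealD.
by split; [apply: depth_ge_tens|apply: not_depth_ge_tens] => //; exact: ideal_mset.
Qed.

End TwoGroupsDepth.
(** * Stanley depth inequalities *)

Lemma eq_cone_depth_ge n (D D' : set 'X_{1..n}) d : (forall w, D w <-> D' w) ->
  cone_depth_ge D d -> cone_depth_ge D' d.
Proof. by move=> DD; rewrite (_ : D' = D) //; apply/seteqP; split=> w /DD. Qed.

Lemma upset_setT n : upset (setT : set 'X_{1..n}). Proof. by []. Qed.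

Lemma upset_set0 n : upset (set0 : set 'X_{1..n}). Proof. by []. Qed.

Arguments upset_setT {n} u w.
Arguments upset_set0 {n} u w.

Section SdepthInequalities.
Context {K : fieldType} {r s : nat}.
Variables (P : set 'X_{1..r}) (Q : set 'X_{1..s}).
Hypotheses (uP : upset P) (uQ : upset Q).
Let L : set 'X_{1..r + s} := pre_left P.
Let M : set 'X_{1..r + s} := pre_right Q.
Let uL : upset L := upset_pre_left uP.
Let uM : upset M := upset_pre_right uQ.

Local Notation sd1 A B := (sdepth (mset A : set {mpoly K[r]}) (mset B)).
Local Notation sd2 A B := (sdepth (mset A : set {mpoly K[s]}) (mset B)).
Local Notation sd A B := (sdepth (mset A : set {mpoly K[r + s]}) (mset B)).

(** [P] is the slice of [L `|` M] at an exponent outside [Q]. *)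
Lemma sdepth_sum_le : ~ Q 0%MM -> (sd (L `|` M) set0 <= sd L set0)%N.
Proof.
move=> nQ0; have [le_n cones] := sdepth_cones (K := K) (upset_setU uL uM) upset_set0.
apply: leq_sdepth le_n _; apply: eq_cone_depth_ge (cone_depth_ge_slice 0%MM cones) => w.
rewrite /L /M /pre_left /pre_right /= mleft_mcat mright_mcat; tauto.
Qed.

Lemma sdepth_sum_ge :
  (minn (sd L set0) (sd2 Q set0 + sd1 setT P) <= sd (L `|` M) set0)%N.
Proof.
have [le_n coneL] := sdepth_cones (K := K) uL upset_set0.
have [_ coneQ] := sdepth_cones (K := K) uQ upset_set0.
have [_ coneP] := sdepth_cones (K := K) upset_setT uP.
apply: leq_sdepth; first by rewrite geq_min le_n.
rewrite [(sd2 _ _ + _)%N]addnC.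
apply: eq_cone_depth_ge (cone_depth_ge_union _ coneL (cone_depth_ge_product coneP coneQ)).
  move=> w; rewrite /L /M /pre_left /pre_right /=.
  by have := pselect (P (mleft w)); tauto.
by move=> w [[Lw _] [[_ nPw] _]].
Qed.

Lemma sdepth_cap_ge : (sd1 P set0 + sd2 Q set0 <= sd (L `&` M) set0)%N.
Proof.
have [le_r coneP] := sdepth_cones (K := K) uP upset_set0.
have [le_s coneQ] := sdepth_cones (K := K) uQ upset_set0.
apply: leq_sdepth; first exact: leq_add.
apply: eq_cone_depth_ge (cone_depth_ge_product coneP coneQ) => w.
by rewrite /L /M /pre_left /pre_right /=; tauto.
Qed.

(** Outside [P] lies the slice of the complement of [L `&` M] at an exponent
    in [Q]. *)
Lemma sdepth_quo_cap_le : (exists v, Q v) -> (sd setT (L `&` M) <= sd setT L)%N.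
Proof.
move=> [v Qv]; have [le_n cones] := sdepth_cones (K := K) upset_setT (upset_setI uL uM).
apply: leq_sdepth le_n _; apply: eq_cone_depth_ge (cone_depth_ge_slice v cones) => w.
rewrite /L /M /pre_left /pre_right /= mleft_mcat mright_mcat; tauto.
Qed.

Lemma sdepth_quo_cap_ge :
  (minn (sd setT L) (sd2 setT Q + sd1 P set0) <= sd setT (L `&` M))%N.
Proof.
have [le_n coneL] := sdepth_cones (K := K) upset_setT uL.
have [_ coneQ] := sdepth_cones (K := K) upset_setT uQ.
have [_ coneP] := sdepth_cones (K := K) uP upset_set0.
apply: leq_sdepth; first by rewrite geq_min le_n.
rewrite [(sd2 _ _ + _)%N]addnC.
apply: eq_cone_depth_ge (cone_depth_ge_union _ coneL (cone_depth_ge_product coneP coneQ)).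
  move=> w; rewrite /L /M /pre_left /pre_right /=.
  by have := pselect (P (mleft w)); tauto.
by move=> w [[_ nLw] [[Pw _] _]].
Qed.

Lemma sdepth_quo_sum_ge : (sd1 setT P + sd2 setT Q <= sd setT (L `|` M))%N.
Proof.
have [le_r coneP] := sdepth_cones (K := K) upset_setT uP.
have [le_s coneQ] := sdepth_cones (K := K) upset_setT uQ.
apply: leq_sdepth; first exact: leq_add.
apply: eq_cone_depth_ge (cone_depth_ge_product coneP coneQ) => w.
by rewrite /L /M /pre_left /pre_right /=; tauto.
Qed.

End SdepthInequalities.

(** * Depth of sums and intersections *)

Section DepthOfMonomialIdeal.
Context {K : fieldType} {n : nat}.
Variable P : set 'X_{1..n}.
Hypotheses (uP : upset P) (P0 : ~ P 0%MM) (exP : exists u, P u).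
Let I : set {mpoly K[n]} := mset P.
Local Notation dge := (@depth_ge _ (max_ideal : set {mpoly K[n]})).

Let iI : is_ideal I := ideal_mset uP.

Let I_max : I `<=` max_ideal.
Proof.
rewrite max_ideal_mset; apply: msetS => u Pu; apply/eqP => u0; apply: P0.
by rewrite -u0.
Qed.

Let I_neq0 : I <> zero_ideal. Proof. exact/mset_neq0. Qed.

Lemma depth_ge_ideal d : dge d setT I <-> dge d.+1 I zero_ideal.
Proof. exact: depth_ideal. Qed.

Lemma exists_depth : exists d, dge d setT I /\ ~ dge d.+1 setT I.
Proof.
have [e] : exists e, ~ dge e setT I by exists n; exact: depth_quotient_lt.
elim: e => [|e ih] ne; first by case: ne.
have [de|/ih//] := pselect (dge e setT I).
by exists e.
Qed.

Lemma depth_monomial_quotient d : dge d setT I -> ~ dge d.+1 setT I -> depth setT I = d.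
Proof.
apply: depth_eq => //; rewrite setT_mset.
by apply: nonzero_mod_max_mset => //; exists 0%MM.
Qed.

Lemma depth_monomial_ideal d : dge d setT I -> ~ dge d.+1 setT I -> depth I zero_ideal = d.+1.
Proof.
move=> dd nd; apply: depth_eq => //; [exact: ideal_zero| |exact/depth_ge_ideal|].
  rewrite zero_ideal_mset; apply: nonzero_mod_max_mset => //.
  by have [u Pu] := exP; exists u; split=> // -[].
by move/depth_ge_ideal.
Qed.

End DepthOfMonomialIdeal.

Section DepthEqualities.
Context {K : fieldType} {r s : nat}.
Variables (P : set 'X_{1..r}) (Q : set 'X_{1..s}).
Hypotheses (uP : upset P) (uQ : upset Q).
Hypotheses (P0 : ~ P 0%MM) (Q0 : ~ Q 0%MM).
Hypotheses (exP : exists u, P u) (exQ : exists v, Q v).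
Let L : set 'X_{1..r + s} := pre_left P.
Let M : set 'X_{1..r + s} := pre_right Q.
Let uL : upset L := upset_pre_left uP.
Let uM : upset M := upset_pre_right uQ.
Local Notation IS := (mset L : set {mpoly K[r + s]}).
Local Notation JS := (mset M : set {mpoly K[r + s]}).
Local Notation ISJS := (mset (L `|` M) : set {mpoly K[r + s]}).
Local Notation IScapJS := (mset (L `&` M) : set {mpoly K[r + s]}).

(** Additivity gives the depths of [S / (IS + JS)], [IS `&` JS] and
    [(IS + JS) / IS]; passing between an ideal and its quotient gives the
    others. *)
Lemma depth_sum_cap : exists a b,
  [/\ depth setT (mset P : set {mpoly K[r]}) = a,
      depth (mset P : set {mpoly K[r]}) zero_ideal = a.+1,
      depth setT (mset Q : set {mpoly K[s]}) = b
    & depth (mset Q : set {mpoly K[s]}) zero_ideal = b.+1] /\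
  [/\ depth setT ISJS = (a + b)%N, depth ISJS zero_ideal = (a + b).+1,
      depth setT IScapJS = (a + b).+1, depth IScapJS zero_ideal = (a + b).+2
    & depth ISJS IS = (a + b).+1].
Proof.
have [a [da na]] := exists_depth (K := K) uP P0 exP.
have [b [db nb]] := exists_depth (K := K) uQ Q0 exQ.
have da' := (depth_ge_ideal (K := K) uP P0 exP a).1 da.
have na' : ~ depth_ge max_ideal a.+2 (mset P : set {mpoly K[r]}) zero_ideal
   by move/(depth_ge_ideal (K := K) uP P0 exP).
have db' := (depth_ge_ideal (K := K) uQ Q0 exQ b).1 db.
have nb' : ~ depth_ge max_ideal b.+2 (mset Q : set {mpoly K[s]}) zero_ideal
   by move/(depth_ge_ideal (K := K) uQ Q0 exQ).
have setE (D D' : set 'X_{1..r + s}) : (forall w, D w <-> D' w) -> D = D'.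
  by move=> DD; apply/seteqP; split=> w /DD.
have uU := upset_setU uL uM; have uI := upset_setI uL uM.
have m00 : mcat 0 0 = 0%MM :> 'X_{1..r + s}.
  by apply/mnmP => i; rewrite mnmE mnm0E; case: split => j; rewrite mnm0E.
have l0 : mleft (0%MM : 'X_{1..r + s}) = 0%MM by rewrite -m00 mleft_mcat.
have r0 : mright (0%MM : 'X_{1..r + s}) = 0%MM by rewrite -m00 mright_mcat.
have nU0 : ~ (L `|` M) 0%MM by rewrite /L /M /pre_left /pre_right /= l0 r0 => -[].
have nI0 : ~ (L `&` M) 0%MM by rewrite /L /pre_left /= l0 => -[].
have [u Pu] := exP; have [v Qv] := exQ.
have Ruv : M (mcat u v) by rewrite /M /pre_right /= mright_mcat.
have Luv : L (mcat u v) by rewrite /L /pre_left /= mleft_mcat.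
have exU : exists w, (L `|` M) w by exists (mcat u v); left.
have exI : exists w, (L `&` M) w by exists (mcat u v); split.
exists a, b; split.
  by split; [exact: depth_monomial_quotient|exact: depth_monomial_ideal|
    exact: depth_monomial_quotient|exact: depth_monomial_ideal].
have [dU nU] : depth_ge max_ideal (a + b) setT ISJS /\ ~ depth_ge max_ideal (a + b).+1 setT ISJS.
  move: da na db nb; rewrite !setT_mset => da na db nb.
  have := depth_tens_mset upset_setT uP upset_setT uQ da na db nb.
  rewrite (setE (pre_left setT `&` pre_right setT) setT) //.
  rewrite (setE (_ `|` _) (L `|` M)) // => w.
  by rewrite /L /M /pre_left /pre_right /=; tauto.
have [dI nI] : depth_ge max_ideal (a + b).+2 IScapJS zero_ideal /\
    ~ depth_ge max_ideal (a + b).+3 IScapJS zero_ideal.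
  move: da' na' db' nb'; rewrite !zero_ideal_mset => da' na' db' nb'.
  have := depth_tens_mset uP upset_set0 uQ upset_set0 da' na' db' nb'.
  rewrite addSn addnS (setE (_ `|` _) set0) // => w.
  by rewrite /pre_left /pre_right /=; tauto.
have [dQ nQ] : depth_ge max_ideal (a + b).+1 JS IScapJS /\
    ~ depth_ge max_ideal (a + b).+2 JS IScapJS.
  move: da na db' nb'; rewrite !zero_ideal_mset !setT_mset => da na db' nb'.
  have := depth_tens_mset upset_setT uP uQ upset_set0 da na db' nb'.
  rewrite addnS (setE (_ `&` _) M); last first.
    by move=> w; rewrite /M /pre_left /pre_right /=; tauto.
  rewrite (setE (_ `|` _) (L `&` M)) // => w.
  by rewrite /L /M /pre_left /pre_right /=; tauto.
have dI' := (depth_ge_ideal (K := K) uI nI0 exI (a + b).+1).2 dI.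
have nI' : ~ depth_ge max_ideal (a + b).+2 setT IScapJS.
  by move/(depth_ge_ideal (K := K) uI nI0 exI (a + b).+2).1.
split; [exact: depth_monomial_quotient|exact: depth_monomial_ideal|
  exact: depth_monomial_quotient|exact: depth_monomial_ideal|].
have iM := @ideal_mset K _ _ uM; have iU := @ideal_mset K _ _ uU; have iL := @ideal_mset K _ _ uL.
have sq : same_quotient JS IScapJS ISJS IS.
  split.
  - by apply: msetS => w; right.
  - by apply: msetS => w; left.
  - move=> x; rewrite -mset_idealD => -[y Ly [z Mz <-]]; exists z => //.
    by rewrite addrK.
  - by move=> x Mx; rewrite -mset_setI; split=> [[]|].
have sqd d := same_quotient_depth_ge max_ideal d iM iU iL sq.
apply: depth_eq => //; [|exact/sqd|by move/sqd].
apply: nonzero_mod_max_mset => //.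
exists (mcat 0 v); split; first by right; rewrite /M /pre_right /= mright_mcat.
by rewrite /L /pre_left /= mleft_mcat.
Qed.

End DepthEqualities.

Theorem theorem1p2 (K : fieldType) (r s : nat) (hr : (0 < r)%N) (hs : (0 < s)%N)
    (I : set {mpoly K[r]}) (J : set {mpoly K[s]})
    (hI : monomial_ideal I) (hJ : monomial_ideal J) :
  let IS : set {mpoly K[r + s]} := extl I in
  let JS : set {mpoly K[r + s]} := extr J in
  (* (1) *)
  (J <> setT ->
     (sdepth (idealD IS JS) zero_ideal <= sdepth IS zero_ideal)%N /\
     (minn (sdepth IS zero_ideal) (sdepth J zero_ideal + sdepth setT I)
        <= sdepth (idealD IS JS) zero_ideal)%N) /\
  (* (2) *)
  (sdepth I zero_ideal + sdepth J zero_ideal <= sdepth (IS `&` JS) zero_ideal)%N /\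
  (* (3) *)
  (J <> zero_ideal ->
     (sdepth setT (IS `&` JS) <= sdepth setT IS)%N /\
     (minn (sdepth setT IS) (sdepth setT J + sdepth I zero_ideal)
        <= sdepth setT (IS `&` JS))%N) /\
  (* (4) *)
  (sdepth setT I + sdepth setT J <= sdepth setT (idealD IS JS))%N /\
  (I <> zero_ideal -> I <> setT -> J <> zero_ideal -> J <> setT ->
     (* (5) *)
     (depth setT (IS `&` JS) = depth setT (idealD IS JS) + 1)%N /\
     (depth setT (idealD IS JS) = depth setT I + depth setT J)%N /\
     (* (6) *)
     (depth (IS `&` JS) zero_ideal = depth (idealD IS JS) zero_ideal + 1)%N /\
     (depth (idealD IS JS) zero_ideal + 1
        = depth I zero_ideal + depth J zero_ideal)%N /\
     depth (idealD IS JS) IS = depth (idealD IS JS) zero_ideal).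
Proof.
have [P uP ->] := monomial_ideal_mset hI; have [Q uQ ->] := monomial_ideal_mset hJ.
move=> IS JS.
have -> : IS = mset (pre_left P) by exact: extl_mset.
have -> : JS = mset (pre_right Q) by exact: extr_mset.
rewrite mset_setI mset_idealD; split; [|split; [|split; [|split]]].
- move=> /(mset_neqT uQ) nQ0; rewrite !zero_ideal_mset setT_mset.
  by split; [exact: sdepth_sum_le|exact: sdepth_sum_ge].
- by rewrite !zero_ideal_mset; exact: sdepth_cap_ge.
- move=> /mset_neq0 exQ; rewrite !zero_ideal_mset !setT_mset.
  by split; [exact: sdepth_quo_cap_le|exact: sdepth_quo_cap_ge].
- by rewrite !setT_mset; exact: sdepth_quo_sum_ge.
- move=> /mset_neq0 exP /(mset_neqT uP) P0 /mset_neq0 exQ /(mset_neqT uQ) Q0.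
  have [a [b [[-> -> -> ->] [-> -> -> -> ->]]]] := depth_sum_cap (K := K) uP uQ P0 Q0 exP exQ.
  by rewrite !addn1 addnS addSn.
Qed.
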